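(* Let $P$ be a law on environments $\omega=(\omega_x)_{x\in\mathbb Z}$ such that: (i) under $P$ the $\omega_x$, $x\in\mathbb Z$, are i.i.d. and there is a constant $c>0$ with $P(\omega_x\in[c,1-c])=1$; (ii) $P(\omega_0\ge 1/2)=1$ and $\alpha:=P(\omega_0=1/2)\in(0,1)$. Then $$\lim_{n\to\infty}\frac{(\ln n)^2}{n}\ln P_\omega(X_{2n}=0)=-\frac{|\pi\ln\alpha|^2}{4},\qquad P\text{-a.s.}$$
   Context: An environment is $\omega=(\omega_x)_{x\in\mathbb Z}\in(0,1)^{\mathbb Z}$; $P$ is a probability law on environments. Given $\omega$, the random walk in random environment $(X_n)_{n\ge0}$ is, under the quenched law $P_\omega$, the time-homogeneous Markov chain on $\mathbb Z$ with $X_0=0$ that from site $x$ jumps to $x+1$ with probability $\omega_x$ and to $x-1$ with probability $1-\omega_x$. *)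

(* Defs.v *)
From HB Require Import structures.
From mathcomp Require Import all_boot all_order all_algebra.
From mathcomp Require Import all_classical all_reals all_analysis.
Set Implicit Arguments.
Unset Strict Implicit.
Unset Printing Implicit Defensive.
Import Order.TTheory GRing.Theory Num.Theory.
Import numFieldNormedType.Exports.
Local Open Scope classical_set_scope.
Local Open Scope ring_scope.

Record env (R : realType) := Env {
  site :> int -> R ;
  site_itv : forall x : int, 0 < site x < 1 }.

HB.instance Definition _ (R : realType) := gen_eqMixin (env R).
HB.instance Definition _ (R : realType) := gen_choiceMixin (env R).

Lemma half_itv (R : realType) (x : int) : 0 < (2^-1 : R) < 1.
Proof. by rewrite invr_gt0 ltr0n /= invf_lt1 ?ltr0n // ltr1n. Qed.

HB.instance Definition _ (R : realType) :=
  isPointed.Build (env R) (Env (half_itv R)).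

(* The product sigma-algebra, i.e. the one generated by the coordinate maps. *)
Section EnvMeasurable.
Variable R : realType.

Definition env_cylinder : set (set (env R)) :=
  [set A | exists (x : int) (B : set R),
     measurable B /\ A = [set w : env R | B (w x)]].

Let env_set0 : <<s env_cylinder >> set0.
Proof. exact: sigma_algebra0. Qed.

Let env_setC A : <<s env_cylinder >> A -> <<s env_cylinder >> (~` A).
Proof. by move=> mA; rewrite -setTD; exact: sigma_algebraCD. Qed.

Let env_bigcup (F : (set (env R))^nat) :
  (forall i, <<s env_cylinder >> (F i)) ->
  <<s env_cylinder >> (\bigcup_i (F i)).
Proof. exact: sigma_algebra_bigcup. Qed.

Definition env_display : measure_display. Proof. by constructor. Qed.

HB.instance Definition _ := @isMeasurable.Build env_display (env R)
  <<s env_cylinder >> env_set0 env_setC env_bigcup.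

End EnvMeasurable.

Definition sites_independent (R : realType) (P : probability (env R) R) : Prop :=
  forall (s : seq int) (B : int -> set R), uniq s ->
    (forall x, measurable (B x)) ->
    P [set w : env R | forall x, x \in s -> B x (w x)]
    = (\prod_(x <- s) P [set w : env R | B x (w x)])%E.

Definition sites_identically_distributed (R : realType)
    (P : probability (env R) R) : Prop :=
  forall (x y : int) (B : set R), measurable B ->
    P [set w : env R | B (w x)] = P [set w : env R | B (w y)].

Definition jump (R : realType) (w : env R) (x y : int) : R :=
  if y == x + 1 then w x else if y == x - 1 then 1 - w x else 0.

(* Under Q, X is the Markov chain started at 0 with transition matrix jump w.
   The Markov property Q(X_(n+1) = y | X_0 = x_0, ..., X_n = x_n) = jump w x_n y
   is multiplied out by the probability of the conditioning event, so that
   nothing is required when that event is null. *)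
Definition quenched_walk (R : realType) (w : env R) (d : measure_display)
    (Om : measurableType d) (Q : probability Om R) (X : nat -> Om -> int) : Prop :=
  [/\ forall (n : nat) (x : int), measurable [set o | X n o = x],
      Q [set o | X 0%N o = 0] = 1%E &
      forall (n : nat) (x : nat -> int) (y : int),
        let past := [set o | forall i, (i <= n)%N -> X i o = x i] in
        Q (past `&` [set o | X n.+1 o = y]) = (Q past * (jump w (x n) y)%:E)%E].

(* Main.v *)
(* By the Markov property the return probability is the 2n-th iterate of the
   transition operator T applied to the indicator of 0, so it can be bounded by
   comparison with positive functions h satisfying T h >= lambda h or
   T h <= lambda h.  To the left of a stretch of l fair sites the drift pushes the
   walk back into the stretch, to the right it pushes the walk away: the stretch
   acts like an interval reflecting on its left end and absorbing on its right
   end, with principal eigenvalue close to cos (pi / (2 l)).  The longest fair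
   stretch within reach has l ~ ln n / |ln alpha|, whence the limit
   2 (ln n)^2 ln cos (pi / (2 l)) ~ - (pi ln alpha)^2 / 4.
   Lower bound: walk to such a stretch at distance n^r with r < 1, stay there,
   and come back.
   Upper bound: almost surely every window of length (1 + eps) ln n / |ln alpha|
   in [-2n, 2n] contains arbitrarily many sites with drift bounded below; each of
   them contracts the phase of the cosine, so that the phase of a supersolution
   with eigenvalue cos theta never reaches pi / 2 when theta is slightly less
   than pi / (2 l). *)

Require Import Defs.
From HB Require Import structures.
From mathcomp Require Import all_boot all_order all_algebra.
From mathcomp Require Import all_classical all_reals all_analysis.
From mathcomp Require Import zify ring lra.
Set Implicit Arguments.
Unset Strict Implicit.
Unset Printing Implicit Defensive.
Import Order.TTheory GRing.Theory Num.Theory.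
Import numFieldNormedType.Exports.
Local Open Scope classical_set_scope.
Local Open Scope ring_scope.

(** * Elementary bounds for sine and cosine *)

Lemma sin_bounds (R : realType) (x : R) : 0 <= x <= pi ->
  x * cos x <= sin x <= x.
Proof.
move=> /andP[x0 xpi]; have [->|xn0] := eqVneq x 0.
  by rewrite sin0 mul0r lexx.
have xgt0 : 0 < x by rewrite lt_neqAle eq_sym xn0.
(* The mean value theorem gives [sin x = x * cos c] with [c] in [[0, x]], where the cosine
   decreases. *)
have [|c /andP[]] := @MVT R sin cos 0 x xgt0 (fun y _ => is_derive_sin y).
  by apply: continuous_subspaceT => y; exact: continuous_sin.
rewrite !bnd_simp => c0 cx; rewrite sin0 !subr0 => ->.
rewrite [_ * x]mulrC ler_piMr ?cos_le1 // ler_wpM2l //.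
by rewrite ltW // ltr_cos // in_itv /=; apply/andP; split; lra.
Qed.

Lemma cos_halfE (R : realType) (x : R) : cos x = 1 - 2 * sin (x / 2) ^+ 2.
Proof.
have -> : cos x = cos (x / 2 + x / 2) by congr cos; lra.
have := cos2Dsin2 (x / 2); rewrite cosD; lra.
Qed.

Lemma cos_ge_quadratic (R : realType) (x : R) : 0 <= x <= pi ->
  1 - x ^+ 2 / 2 <= cos x.
Proof.
move=> /andP[x0 xpi]; rewrite cos_halfE.
have /andP[_ s1] : x / 2 * cos (x / 2) <= sin (x / 2) <= x / 2.
  by apply: sin_bounds; lra.
have s0 : 0 <= sin (x / 2) by apply: sin_ge0_pi; lra.
nra.
Qed.

(** Combines [sin y >= y * cos y] at [y = x / 2] with [cos y ^+ 2 = 1 - sin y ^+ 2 >= 1 - y ^+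
    2]. *)
Lemma cos_le_quartic (R : realType) (x : R) : 0 <= x <= pi / 2 ->
  cos x <= 1 - x ^+ 2 / 2 * (1 - x ^+ 2 / 4).
Proof.
move=> /andP[x0 xpi]; rewrite cos_halfE.
have pi0 := pi_gt0 R.
have /andP[s1 s2] : x / 2 * cos (x / 2) <= sin (x / 2) <= x / 2.
  by apply: sin_bounds; lra.
have s0 : 0 <= sin (x / 2) by apply: sin_ge0_pi; lra.
have c0 : 0 <= cos (x / 2) by apply: cos_ge0_pihalf; lra.
have : (x / 2 * cos (x / 2)) ^+ 2 <= sin (x / 2) ^+ 2.
  by rewrite ler_sqr ?nnegrE //; nra.
have : sin (x / 2) ^+ 2 <= (x / 2) ^+ 2 by rewrite ler_sqr ?nnegrE //; nra.
move=> /(ler_wpM2l (sqr_ge0 x)); 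
have := cos2sin2 (x / 2); nra.
Qed.

(** * Comparison functions for the transition operator *)

Definition walk_step (R : pzRingType) (w f : int -> R) (x : int) : R :=
  w x * f (x + 1) + (1 - w x) * f (x - 1).

(* [return_prob w k x] is the probability that the walk in [w] started at [x]
   is at the origin at time [k]. *)
Definition return_prob (R : pzRingType) (w : int -> R) (k : nat) : int -> R :=
  iter k (walk_step w) (fun x => (x == 0)%:R).

Section Comparison.
Variables (R : realType) (w : int -> R).
Hypothesis w01 : forall x, 0 < w x < 1.

Lemma return_prob_ge0 k x : 0 <= return_prob w k x.
Proof.
elim: k x => [|k IH] x /=; first exact: ler0n.
have /andP[w0 w1] := w01 x.
by rewrite /walk_step addr_ge0 // mulr_ge0 ?IH //; lra.
Qed.

(** Induction on time, starting from the fact that [h 0] times the indicator of the origin is at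
    most [h]. In [k] steps the walk moves at most [k] sites, so a supersolution on a finite window
    suffices. *)
Lemma return_prob_le_supersolution (h : int -> R) (lam : R) (N : nat) :
  0 <= lam -> (forall x, (`|x| <= N)%N -> 0 <= h x) ->
  (forall x, (`|x| < N)%N -> walk_step w h x <= lam * h x) ->
  forall k x, (`|x| + k <= N)%N ->
  return_prob w k x * h 0 <= lam ^+ k * h x.
Proof.
move=> lam0 h0 hsup; elim=> [|k IH] x xN /=.
  rewrite expr0 mul1r; have [->|_] := eqVneq x 0; first by rewrite mul1r.
  by rewrite mul0r h0 //; lia.
have /andP[w0 w1] := w01 x.
apply: (@le_trans _ _ (lam ^+ k * walk_step w h x)); last first.
  by rewrite exprSr -mulrA ler_wpM2l ?exprn_ge0 // hsup //; lia.
have H1 := IH (x + 1) ltac:(lia).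
have H2 := IH (x - 1) ltac:(lia).
rewrite /walk_step -/(return_prob w k).
have := ler_wpM2l (ltW w0) H1.
have : 0 <= 1 - w x by lra.
by move=> /ler_wpM2l /(_ _ _ H2); lra.
Qed.

(** Follow one path: step towards the origin, and step right when at the origin. Each step has
    probability at least [c], and the parity condition makes the path end at the origin. *)
Lemma return_prob_ge_exp (c : R) : 0 < c ->
  (forall x, c <= w x <= 1 - c) ->
  forall k x, (`|x| <= k)%N -> ~~ odd (`|x| + k) -> c ^+ k <= return_prob w k x.
Proof.
move=> c0 wc; elim=> [|k IH] x xk xp /=.
  by rewrite expr0 (_ : x = 0) //; lia.
have /andP[w0 w1] := wc x.
have r0 := return_prob_ge0 k.
have ck : 0 <= c ^+ k by rewrite exprn_ge0 // ltW.
have step y (v : R) : c <= v -> c ^+ k <= return_prob w k y ->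
    c ^+ k.+1 <= v * return_prob w k y.
  by move=> cv ck'; rewrite exprS; apply: ler_pM => //; exact: ltW.
rewrite /walk_step -/(return_prob w k).
have [x0|x0] := lerP x 0.
  apply: ler_wpDr; first by rewrite mulr_ge0 //; lra.
  by apply: step => //; apply: IH; lia.
apply: ler_wpDl; first by rewrite mulr_ge0 //; lra.
by apply: step; [lra|apply: IH; lia].
Qed.

Lemma iter_walk_step_ge (c : R) (f : int -> R) : 0 < c ->
  (forall x, c <= w x) -> (forall x, 0 <= f x) ->
  forall a x, c ^+ a * f (x + a%:Z) <= iter a (walk_step w) f x.
Proof.
move=> c0 wc f0 a x; elim: a f f0 x => [|a IH] f f0 x.
  by rewrite expr0 mul1r addr0.
rewrite iterSr.
have g0 y : 0 <= walk_step w f y.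
  by have /andP[? ?] := w01 y; rewrite addr_ge0 // mulr_ge0 //; lra.
apply: le_trans (IH _ g0 x).
rewrite exprSr -mulrA ler_wpM2l ?exprn_ge0 ?(ltW c0) //.
have /andP[w0 w1] := w01 (x + a%:Z).
apply: ler_wpDr; first by rewrite mulr_ge0 //; lra.
rewrite (_ : x + a.+1 = x + a%:Z + 1) ?ler_wpM2r //; lia.
Qed.

(** The bound [b * h <= f] is assumed on one parity class only, because a return probability
    vanishes on the other; each step switches the class, and the induction keeps track of it. *)
Lemma iter_walk_step_subsolution (h f : int -> R) (lam b : R) (D : nat) :
  0 <= b -> 0 <= lam -> (forall x, lam * h x <= walk_step w h x) ->
  (forall x, ~~ odd (`|x| + D) -> b * h x <= f x) ->
  forall m x, ~~ odd (`|x| + (D + m)) ->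
  b * lam ^+ m * h x <= iter m (walk_step w) f x.
Proof.
move=> b0 lam0 hsub hf; elim=> [|m IH] x xp.
  by rewrite expr0 mulr1 hf // -[D]addn0.
have /andP[w0 w1] := w01 x.
rewrite iterS {1}/walk_step.
apply: (@le_trans _ _ (b * lam ^+ m * walk_step w h x)).
  by rewrite exprSr !mulrA -mulrA ler_wpM2l // mulr_ge0 // exprn_ge0.
have H1 := IH (x + 1) ltac:(lia).
have H2 := IH (x - 1) ltac:(lia).
rewrite /walk_step.
have := ler_wpM2l (ltW w0) H1.
have : 0 <= 1 - w x by lra.
by move=> /ler_wpM2l /(_ _ _ H2); lra.
Qed.

End Comparison.

(* On the fair stretch [cos (theta (x - a))] is an eigenfunction; to the left of
   [a] it is increasing, so the drift to the right only helps. *)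
Lemma walk_step_cos_ge (R : realType) (w : int -> R) (a : int) (l : nat) :
  let theta : R := pi / 2 / l%:R in
  let h (x : int) : R :=
    if (`|x - a| <= l)%N then cos (theta * (x - a)%:~R) else 0 in
  (forall x, 0 < w x < 1) -> (forall x, 2^-1 <= w x) -> (0 < l)%N ->
  (forall i, (i < l)%N -> w (a + i%:Z) = 2^-1) ->
  forall x, cos theta * h x <= walk_step w h x.
Proof.
move=> theta h w01 whalf l0 fair x.
have pi0 := pi_gt0 R.
have l0R : 0 < l%:R :> R by rewrite ltr0n.
have th0 : 0 < theta by rewrite /theta !divr_gt0.
have thl : theta * l%:R = pi / 2 by rewrite /theta divfK // gt_eqF.
have hcos y : (`|y - a| <= l)%N -> - (pi / 2) <= theta * (y - a)%:~R <= pi / 2.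
  move=> yl; rewrite -ler_norml normrM (gtr0_norm th0) -intr_norm -thl.
  by rewrite ler_pM2l // -abszE -pmulrn ler_nat.
have h0 y : 0 <= h y.
  by rewrite /h; case: ifP => // /hcos; exact: cos_ge0_pihalf.
have cosl y : `|y - a|%N = l -> h y = 0.
  move=> yl; rewrite /h yl leqnn -cos_norm normrM (gtr0_norm th0) -intr_norm.
  by rewrite -abszE yl -pmulrn thl cos_pihalf.
have /andP[w0 w1] := w01 x.
have step0 : 0 <= walk_step w h x.
  by rewrite addr_ge0 // mulr_ge0 //; lra.
(* At distance [l] from [a] and beyond, [h] vanishes and nonnegativity of the step is enough. *)
have [xl|xl] := ltnP `|x - a|%N l; last first.
  have [/cosl->|xl'] := eqVneq `|x - a|%N l; first by rewrite mulr0.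
  by rewrite /h ifF ?mulr0 //; lia.
set u : R := theta * (x - a)%:~R.
have hx : h x = cos u by rewrite /h ifT //; lia.
have hp : h (x + 1) = cos (u + theta).
  rewrite /h ifT; last by lia.
  by rewrite addrAC intrD mulrDr mulr1.
have hm : h (x - 1) = cos (u - theta).
  rewrite /h ifT; last by lia.
  by rewrite addrAC intrB mulrBr mulr1.
rewrite /walk_step hp hm hx cosB cosD.
have [xa|xa] := lerP a x.
  have := fair `|x - a|%N xl; rewrite (_ : a + _ = x) => [->|]; last by lia.
  lra.
have su : sin u <= 0.
  rewrite -oppr_ge0 -sinN sin_ge0_pi //.
  have /andP[u1 _] := hcos x (ltnW xl); rewrite -/u in u1.
  have u2 : u <= 0.
    by rewrite /u pmulr_rle0 // lerz0; lia.
  by apply/andP; split; lra.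
have st : 0 <= sin theta.
  apply: sin_ge0_pi; rewrite (ltW th0) /= /theta.
  have : theta <= pi / 2.
    by rewrite -thl ler_peMr ?(ltW th0) // ler1n.
  by rewrite -/theta; lra.
have w2 : 1 - 2 * w x <= 0 by have := whalf x; lra.
by have := mulr_le0 w2 (mulr_le0_ge0 su st); lra.
Qed.

(** A strategy in three stages: [a] steps right to the stretch, [m] steps there at the price
    [cos theta] each, then [a + l] steps along a path back to the origin. *)
Lemma return_prob_ge (R : realType) (w : int -> R) (c : R) (a l n : nat) :
  (forall x, 0 < w x < 1) -> (forall x, 2^-1 <= w x) ->
  0 < c -> (forall x, c <= w x <= 1 - c) ->
  (0 < l)%N -> (2 * a + l <= 2 * n)%N ->
  (forall i, (i < l)%N -> w (a%:Z + i%:Z) = 2^-1) ->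
  c ^+ (2 * a + l) * cos (pi / 2 / l%:R) ^+ (2 * n) <= return_prob w (2 * n) 0.
Proof.
move=> w01 whalf c0 wc l0 aln fair.
set theta : R := pi / 2 / l%:R.
have pi0 := pi_gt0 R.
have l0R : 0 < l%:R :> R by rewrite ltr0n.
have th0 : 0 < theta by rewrite /theta !divr_gt0.
have thl : theta * l%:R = pi / 2 by rewrite /theta divfK // gt_eqF.
have thp : theta <= pi / 2 by rewrite -thl ler_peMr ?(ltW th0) // ler1n.
have ct0 : 0 <= cos theta by apply: cos_ge0_pihalf; apply/andP; split; lra.
pose m := (2 * n - (2 * a + l))%N.
have -> : (2 * n = a + (m + (a + l)))%N by rewrite /m; lia.
rewrite /return_prob iterD (iterD m) -/(return_prob w (a + l)).
have ca k : 0 <= c ^+ k by rewrite exprn_ge0 // ltW.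
pose h (x : int) : R :=
  if (`|x - a%:Z| <= l)%N then cos (theta * (x - a%:Z)%:~R) else 0.
have hsub : forall x, cos theta * h x <= walk_step w h x.
  exact: walk_step_cos_ge.
have hle x : (`|x| <= a + l)%N \/ h x = 0.
  rewrite /h; case: ifP => H; last by right.
  by left; move: H; lia.
have hle1 x : h x <= 1.
  by rewrite /h; case: ifP => // _; exact: cos_le1.
have iter_ge0 f k x : (forall y, 0 <= f y) -> 0 <= iter k (walk_step w) f x.
  move=> f0; elim: k x => //= k IH x; have /andP[? ?] := w01 x.
  by rewrite addr_ge0 // mulr_ge0 ?IH //; lra.
set f := return_prob w (a + l).
have f0 x : 0 <= f x by exact: return_prob_ge0.
have wc0 x : c <= w x by have /andP[] := wc x.
apply: le_trans (iter_walk_step_ge w01 c0 wc0 (fun x => iter_ge0 f m x f0) a 0).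
rewrite add0r.
have hfx (x : int) : ~~ odd (`|x| + (a + l)) -> c ^+ (a + l) * h x <= f x.
  move=> xp; have [xl|->] := hle x; last by rewrite mulr0 f0.
  apply: (@le_trans _ _ (c ^+ (a + l))); first by rewrite ler_piMr.
  exact: return_prob_ge_exp.
have := iter_walk_step_subsolution w01 (ca _) ct0 hsub hfx (m := m) (x := a%:Z).
have -> : h a%:Z = 1 by rewrite /h subrr absz0 leq0n mulr0 cos0.
(* Only [m] of the [2 * n] steps pay [cos theta]; the surplus factors are at most 1. *)
rewrite mulr1 => H; apply: (@le_trans _ _ (c ^+ a * (c ^+ (a + l) * cos theta ^+ m))).
  rewrite (_ : (2 * a + l = a + (a + l))%N); last by lia.
  rewrite exprD -!mulrA ler_wpM2l // ler_wpM2l //.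
  rewrite (_ : (a + (m + (a + l)) = m + (a + (a + l)))%N); last by lia.
  by rewrite exprD ler_piMr ?exprn_ge0 // exprn_ile1 // cos_le1.
by rewrite ler_wpM2l // H //; rewrite /m; lia.
Qed.

(** * Phases and supersolutions *)

(* A site of drift [v >= p] multiplies the tangent of the phase by
   [(1 - v) / v]; for phases at most [M] this is dominated by multiplying the
   phase itself by [k]. *)
Lemma phase_contraction (R : realType) (p v M x : R) :
  let k := 1 - (2 * p - 1) * cos M ^+ 2 in
  2^-1 <= p -> p <= v <= 1 -> 0 <= x <= M -> M < pi / 2 ->
  (1 - v) * (sin x * cos (k * x)) <= v * (sin (k * x) * cos x).
Proof.
move=> k p2 /andP[pv v1] /andP[x0 xM] Mpi.
have pi0 := pi_gt0 R.
have m0 : 0 <= cos M by apply: cos_ge0_pihalf; apply/andP; split; lra.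
have m1 := cos_le1 M.
have q0 : 0 <= (2 * p - 1) * cos M ^+ 2 by rewrite mulr_ge0 ?exprn_ge0 //; lra.
have q1 : (2 * p - 1) * cos M ^+ 2 <= 1.
  by rewrite mulr_ile1 ?exprn_ge0 ?exprn_ile1 //; lra.
have k01 : 0 <= k <= 1 by rewrite /k; apply/andP; split; lra.
have /andP[k0 k1] := k01.
have kx : 0 <= k * x <= x by rewrite mulr_ge0 //= ler_piMl.
have /andP[kx0 kxx] := kx.
have cos_anti (a b : R) : 0 <= a -> a <= b -> b <= pi -> cos b <= cos a.
  by move=> a0 ab bpi; rewrite leNgt ltr_cos ?in_itv /= -?leNgt //; lra.
have c1 : cos M <= cos x by apply: cos_anti; lra.
have c2 : cos M <= cos (k * x) by apply: cos_anti; lra.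
have /andP[s1 _] : x * cos x <= sin x <= x by apply: sin_bounds; lra.
have /andP[_ s2] : (1 - k) * x * cos ((1 - k) * x) <= sin ((1 - k) * x)
    <= (1 - k) * x.
  by apply: sin_bounds; apply/andP; split; [rewrite mulr_ge0 //; lra|lra].
have E : sin ((1 - k) * x) = sin x * cos (k * x) - sin (k * x) * cos x.
  by rewrite (_ : (1 - k) * x = x - k * x) ?sinB; [ring|ring].
(* Of the two factors [cos M] in [1 - k], one bounds [sin x / x] from below, the other
   [cos (k * x)]. *)
have s3 : x * cos M <= sin x by apply: le_trans s1; rewrite ler_wpM2l.
have s4 : x * cos M * cos M <= sin x * cos (k * x).
  by apply: ler_pM; rewrite // mulr_ge0.
have s5 : sin ((1 - k) * x) <= (2 * p - 1) * (sin x * cos (k * x)).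
  apply: (le_trans s2); rewrite /k (_ : _ * x = (2 * p - 1) * (x * cos M * cos M)).
    by rewrite ler_wpM2l //; lra.
  ring.
have s6 : 0 <= sin x * cos (k * x).
  by apply: le_trans s4; rewrite !mulr_ge0.
have s7 : 0 <= sin ((1 - k) * x).
  by apply: sin_ge0_pi; apply/andP; split; [rewrite mulr_ge0 //; lra|lra].
(* Since [sin ((1 - k) * x)] is the difference of the two products in the goal, this is the goal
   rearranged. *)
have : v * sin ((1 - k) * x) <= (2 * v - 1) * (sin x * cos (k * x)).
  apply: (@le_trans _ _ (sin ((1 - k) * x))); first by rewrite ler_piMl.
  by apply: (le_trans s5); rewrite ler_wpM2r //; lra.
rewrite E; lra.
Qed.

(** Here [f] and [g] are the phases before and after a site of drift [v]; the quotients are the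
    values of the supersolution at the two neighbours relative to the site. By the addition formulas
    the gap between the two sides is [sin theta / (cos f * cos g)] times the gap in the last
    hypothesis. *)
Lemma supersolution_ratio (R : realType) (v f g theta : R) :
  0 < cos f -> 0 < cos g -> 0 <= sin theta ->
  (1 - v) * (sin f * cos g) <= v * (sin g * cos f) ->
  v * (cos (g + theta) / cos g) + (1 - v) * (cos (f - theta) / cos f)
    <= cos theta.
Proof.
move=> cf cg st H; rewrite cosD cosB.
have fn0 : cos f != 0 by rewrite gt_eqF.
have gn0 : cos g != 0 by rewrite gt_eqF.
rewrite -subr_ge0 (_ : _ - _ = sin theta / (cos f * cos g) *
   (v * (sin g * cos f) - (1 - v) * (sin f * cos g))); last first.
  by field; apply/andP.
by rewrite mulr_ge0 ?subr_ge0 // divr_ge0 // ltW // mulr_gt0.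
Qed.

Fixpoint phase (R : pzRingType) (k : nat -> R) (theta : R) (i : nat) : R :=
  if i is j.+1 then k j * phase k theta j + theta else 0.

Section Phase.
Variables (R : realType) (k : nat -> R) (theta : R).
Hypotheses (k01 : forall i, 0 <= k i <= 1) (theta0 : 0 <= theta).

Lemma phase_ge0 i : 0 <= phase k theta i.
Proof.
elim: i => //= i IH; have /andP[? _] := k01 i.
by rewrite addr_ge0 // mulr_ge0.
Qed.

(** The contractions act in full on the initial phase, while their effect on the increments [theta]
    is bounded by 1. *)
Lemma phase_window i j : phase k theta (i + j) <=
  (\prod_(m < j) k (i + m)) * phase k theta i + j%:R * theta.
Proof.
elim: j => [|j IH]; first by rewrite addn0 big_ord0 mul1r mul0r addr0.
rewrite addnS /= big_ord_recr /= -natr1 mulrDl mul1r addrA lerD2r.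
have /andP[k0 k1] := k01 (i + j).
apply: (le_trans (ler_wpM2l k0 IH)).
rewrite mulrDr [_ * k _]mulrC mulrA lerD2l.
by rewrite ler_piMl // mulr_ge0.
Qed.

(** [B] is the fixed point of [x |-> q * x + (1 - q) * B], which dominates the change of phase over
    [l] sites; the strong induction goes back [l] sites at a time. The first [l] sites start from
    phase 0. *)
Lemma phase_le (q B : R) (l N : nat) : (0 < l)%N -> 0 <= q ->
  l%:R * theta <= (1 - q) * B -> 0 <= B ->
  (forall i, (i <= N)%N -> \prod_(m < l) k (i + m) <= q) ->
  forall i, (i <= N)%N -> phase k theta i <= B.
Proof.
move=> l0 q0 lB B0 hq; elim/ltn_ind => i IH iN.
have [il|li] := ltnP i l.
  have := phase_window 0 i; rewrite add0n mulr0 add0r => /le_trans; apply.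
  apply: (@le_trans _ _ (l%:R * theta)); first by rewrite ler_wpM2r // ler_nat ltnW.
  by apply: (le_trans lB); rewrite ler_piMl //; lra.
rewrite -(subnK li).
apply: (le_trans (phase_window _ _)).
have H1 : \prod_(m < l) k (i - l + m) <= q by apply: hq; lia.
have H2 : phase k theta (i - l) <= B by apply: IH; lia.
have P0 : 0 <= \prod_(m < l) k (i - l + m).
  by apply: prodr_ge0 => m _; have /andP[] := k01 (i - l + m)%N.
have := ler_pM P0 (phase_ge0 (i - l)) H1 H2; lra.
Qed.

End Phase.

(* Locally [cos (phase + _)]: just before the site [j.+1] the phase is
   [phase j.+1], just after it [k j.+1 * phase j.+1]. *)
Fixpoint supersolution (R : realType) (k : nat -> R) (theta : R) (i : nat) : R :=
  if i is j.+1 then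
    supersolution k theta j * (cos (phase k theta i) / cos (k j * phase k theta j))
  else 1.

(** Phases in [[0, M]] with [M < pi / 2] keep all cosines, hence [h], positive; after factoring out
    [h i.+1] the inequality at a site is [supersolution_ratio]. *)
Lemma supersolution_ineq (R : realType) (k e : nat -> R) (theta M : R) (N : nat) :
  (forall i, 0 <= k i <= 1) -> 0 <= theta <= M -> M < pi / 2 ->
  (forall i x, 0 <= x <= M ->
    (1 - e i) * (sin x * cos (k i * x)) <= e i * (sin (k i * x) * cos x)) ->
  (forall i, (i <= N)%N -> phase k theta i <= M) ->
  let h := supersolution k theta in
  (forall i, (i <= N)%N -> 0 < h i) /\
  (forall i, (i.+2 <= N)%N ->
    e i.+1 * h i.+2 + (1 - e i.+1) * h i <= cos theta * h i.+1).
Proof.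
move=> k01 /andP[th0 thM] Mpi contr phM h.
have pi0 := pi_gt0 R.
have ph0 := phase_ge0 k01 th0.
have cpos x : 0 <= x <= M -> 0 < cos x.
  by move=> /andP[? ?]; apply: cos_gt0_pihalf; apply/andP; split; lra.
have kph i : (i <= N)%N -> 0 <= k i * phase k theta i <= M.
  move=> iN; have /andP[? ?] := k01 i.
  by rewrite mulr_ge0 //= (le_trans _ (phM i iN)) // ler_piMl.
have h0 i : (i <= N)%N -> 0 < h i.
  rewrite /h; elim: i => [//|i IH] iN; rewrite [supersolution _ _ _]/=.
  rewrite mulr_gt0 ?IH ?divr_gt0 //; first exact: ltnW.
    by apply: cpos; rewrite (ph0 i.+1) (phM i.+1).
  by apply: cpos; apply: kph; exact: ltnW.
split=> // i iN; have i1N := ltnW iN; have i0N := ltnW i1N.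
have st : 0 <= sin theta by apply: sin_ge0_pi; apply/andP; split; lra.
set f := phase k theta i.+1; set g := k i.+1 * f.
have f0M : 0 <= f <= M by rewrite /f ph0 phM.
have cf : 0 < cos f := cpos _ f0M.
have cg : 0 < cos g by apply: cpos; exact: kph.
have cfm : 0 < cos (k i * phase k theta i) by apply: cpos; exact: kph.
have E1 : h i.+2 = h i.+1 * (cos (g + theta) / cos g) by [].
(* Seen backwards, the phase just after the previous site is [f - theta]. *)
have E2 : h i = h i.+1 * (cos (f - theta) / cos f).
  rewrite (_ : f - theta = k i * phase k theta i); last by rewrite /f /= addrK.
  rewrite /h [supersolution _ _ i.+1]/= -/(phase k theta i.+1) -/f.
  by field; rewrite !gt_eqF.
rewrite E1 E2 mulrCA [(1 - _) * _]mulrCA -mulrDr.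
rewrite [cos theta * _]mulrC ler_wpM2l //; first exact/ltW/h0.
by apply: supersolution_ratio => //; exact: contr.
Qed.

Lemma return_prob_le (R : realType) (w : int -> R) (p M q theta : R) (l K n : nat) :
  (forall x, 0 < w x < 1) -> (forall x, 2^-1 <= w x) -> 2^-1 <= p <= 1 ->
  0 <= M < pi / 2 -> q = 1 - (2 * p - 1) * cos M ^+ 2 ->
  0 <= theta -> (0 < l)%N -> l%:R * theta <= (1 - q ^+ K) * M ->
  (forall x : int, (`|x| <= 2 * n)%N ->
    (K <= \sum_(m < l) (p <= w (x + m%:Z))%R)%N) ->
  return_prob w (2 * n) 0 <= cos theta ^+ (2 * n).
Proof.
move=> w01 whalf /andP[p2 p1] /andP[M0 Mpi] qE th0 l0 lth.
move: (2 * n)%N => N hw.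
have pi0 := pi_gt0 R.
have m0 : 0 <= cos M by apply: cos_ge0_pihalf; apply/andP; split; lra.
have m1 := cos_le1 M.
have q01 : 0 <= q <= 1.
  have q0 : 0 <= (2 * p - 1) * cos M ^+ 2 by rewrite mulr_ge0 ?exprn_ge0 //; lra.
  have q1 : (2 * p - 1) * cos M ^+ 2 <= 1.
    by rewrite mulr_ile1 ?exprn_ge0 ?exprn_ile1 //; lra.
  by rewrite qE; apply/andP; split; lra.
have qK : 0 <= q ^+ K <= 1 by have /andP[? ?] := q01; rewrite exprn_ge0 // exprn_ile1.
(* The window [[-N, N]] is reindexed by natural numbers, the phase being 0 at its left end. *)
have [e eE] : exists e : nat -> R, forall i, e i = w (i%:Z - N%:Z).
  by exists (fun i : nat => w (i%:Z - N%:Z)).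
have [k kE] : exists k : nat -> R, forall i, k i = if p <= e i then q else 1.
  by exists (fun i => if p <= e i then q else 1).
have k01 i : 0 <= k i <= 1 by rewrite kE; case: ifP => // _; rewrite ler01 lexx.
have iabs i : (i <= 2 * N)%N -> (`|(i%:Z - N%:Z)%R| <= N)%N.
  by clear; lia.
have phM i : (i <= 2 * N)%N -> phase k theta i <= M.
  apply: (@phase_le _ k theta k01 th0 (q ^+ K) M l (2 * N)) => //.
    by have /andP[] := qK.
  move=> {}i iN.
  have -> : \prod_(m < l) k (i + m)%N =
      q ^+ (\sum_(m < l) (p <= w (i%:Z - N%:Z + m%:Z))%R).
    rewrite expr_sum; apply: eq_bigr => m _; rewrite kE eE PoszD addrAC.
    by case: (p <= _).
  have /andP[? ?] := q01.
  by apply: ler_wiXn2l => //; apply/hw/iabs.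
have thM : theta <= M.
  have /andP[? ?] := qK.
  apply: le_trans (le_trans lth _); first by rewrite ler_peMl // ler1n.
  by rewrite ler_piMl //; lra.
have contr i x : 0 <= x <= M ->
    (1 - e i) * (sin x * cos (k i * x)) <= e i * (sin (k i * x) * cos x).
  move=> xM; rewrite kE; case: ifP => pe.
    rewrite qE; apply: phase_contraction => //.
    by rewrite pe eE /=; have /andP[_ /ltW] := w01 (i%:Z - N%:Z).
  have /andP[x0 xM'] := xM.
  (* With [k i = 1] the two products coincide, and the inequality is [1 - e i <= e i]. *)
  rewrite mul1r ler_wpM2r //; last by rewrite eE; have := whalf (i%:Z - N%:Z); lra.
  rewrite mulr_ge0 //.
    by apply: sin_ge0_pi; apply/andP; split; lra.
  by apply: cos_ge0_pihalf; apply/andP; split; lra.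
have thM' : 0 <= theta <= M by rewrite th0.
have [] := supersolution_ineq k01 thM' Mpi contr phM.
move: (supersolution k theta) => h h0 hsup.
have ct : 0 <= cos theta by apply: cos_ge0_pihalf; apply/andP; split; lra.
have := @return_prob_le_supersolution R w w01 (fun x => h `|(x + N%:Z)%R|%N)
  (cos theta) N ct.
clear - w01 h0 hsup eE => H.
have h00 : 0 < h `|(0 + N%:Z)%R|%N by apply: h0; lia.
rewrite -(ler_pM2r h00); apply: H => //.
- by move=> x xN; apply: ltW; apply: h0; lia.
- move=> x xN; rewrite /walk_step.
  have [i Ei] : exists i : nat, x + N%:Z = i.+1%:Z.
    by exists `|(x + N%:Z - 1)%R|%N; lia.
  have -> : `|(x + 1 + N%:Z)%R|%N = i.+2 by lia.
  have -> : `|(x - 1 + N%:Z)%R|%N = i by lia.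
  have -> : `|(x + N%:Z)%R|%N = i.+1 by lia.
  have -> : w x = e i.+1 by rewrite eE -Ei addrK.
  by apply: hsup; lia.
Qed.

(** * Independent sites *)

Section Probability.
Variables (d : measure_display) (T : measurableType d) (R : realType).
Variable P : probability T R.

Definition pr (A : set T) : R := fine (P A).

Lemma prE A : measurable A -> P A = (pr A)%:E.
Proof. by move=> mA; rewrite /pr fineK // fin_num_measure. Qed.

Lemma pr_ge0 A : 0 <= pr A.
Proof. by rewrite /pr fine_ge0. Qed.

Lemma pr_le1 A : measurable A -> pr A <= 1.
Proof. by move=> mA; rewrite -lee_fin -prE // probability_le1. Qed.

Lemma pr_setT : pr setT = 1.
Proof. by rewrite /pr probability_setT. Qed.

Lemma pr_set0 : pr set0 = 0.
Proof. by rewrite /pr measure0. Qed.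

Lemma prU A B : measurable A -> measurable B -> A `&` B = set0 ->
  pr (A `|` B) = pr A + pr B.
Proof.
move=> mA mB AB; apply: EFin_inj.
rewrite EFinD -!prE //; first by rewrite measureU.
exact: measurableU.
Qed.

Lemma le_pr A B : measurable A -> measurable B -> A `<=` B -> pr A <= pr B.
Proof.
by move=> mA mB AB; rewrite -lee_fin -!prE // le_measure // ?inE.
Qed.

Lemma pr_split A B : measurable A -> measurable B ->
  pr A = pr (A `&` B) + pr (A `&` ~` B).
Proof.
move=> mA mB; rewrite -prU.
- by rewrite -setIUr setUv setIT.
- exact: measurableI.
- by apply: measurableI => //; exact: measurableC.
- by apply/seteqP; split => // x [[_ ?] [_ ?]].
Qed.

Lemma pr_bigU_le (A : nat -> set T) (n : nat) (c : R) :
  (forall i, measurable (A i)) -> (forall i, pr (A i) <= c) ->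
  measurable [set x | exists2 i, (i < n)%N & A i x] /\
  pr [set x | exists2 i, (i < n)%N & A i x] <= n%:R * c.
Proof.
move=> mA Ac; elim: n => [|n [mU IH]].
  rewrite (_ : [set _ | _] = set0) ?pr_set0 ?mul0r //.
  by apply/seteqP; split => // x [].
set U := [set x | _] in mU IH.
rewrite (_ : [set _ | _] = A n `|` (U `&` ~` A n)); last first.
  apply/seteqP; split=> x /=.
    move=> [i ilt Ai]; have [?|nA] := pselect (A n x); [by left|right].
    split=> //; exists i => //.
    have [ine|//] := eqVneq i n; first by rewrite ine in Ai.
    by lia.
  move=> [An|[[i ilt Ai] _]]; first by exists n.
  by exists i => //; exact: ltnW.
have mC : measurable (U `&` ~` A n) by apply: measurableI => //; exact: measurableC.
split; first exact: measurableU.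
rewrite prU //; last by apply/seteqP; split => // x [? [_ ?]].
have : pr (U `&` ~` A n) <= pr U by apply: le_pr => // x [].
rewrite -natr1 mulrDl mul1r; have := Ac n; lra.
Qed.

Lemma ae_of_probability1 (Q : set T) : measurable Q -> P Q = 1%E ->
  {ae P, forall x, Q x}.
Proof.
move=> mQ Q1; exists (~` Q); split=> //; first exact: measurableC.
by rewrite probability_setC // Q1 subee.
Qed.

Lemma borel_cantelli_geometric (F : nat -> set T) (a q : R) :
  (forall n, measurable (F n)) -> 0 <= a -> 0 < q < 1 ->
  (forall n, (0 < n)%N -> pr (F n) <= a * q ^+ n) ->
  {ae P, forall x, \forall n \near \oo, ~ F n x}.
Proof.
move=> mF a0 /andP[q0 q1] Fle.
(* No bound is assumed at [n = 0], so [F 0] is replaced by the empty set. *)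
pose G n := if n is 0%N then set0 else F n.
have mG n : measurable (G n) by case: n => //=.
have Gle n : pr (G n) <= a * q ^+ n.
  by case: n => [|n] /=; [rewrite pr_set0 expr0 mulr1|exact: Fle].
exists (lim_sup_set G); split.
- by apply: bigcap_measurable => // k _; exact: bigcup_measurable.
- apply: lim_sup_set_cvg0 => //.
  apply: (@le_lt_trans _ _ (a / (1 - q))%:E); last exact: ltry.
  apply: lime_le; first exact: is_cvg_nneseries.
  apply: nearW => n /=; rewrite (eq_bigr (fun i => (pr (G i))%:E)); last first.
    by move=> i _; rewrite prE.
  rewrite sumEFin lee_fin.
  apply: (@le_trans _ _ (series (geometric a q) n)).
    by apply: ler_sum => i _; exact: Gle.
  by apply: geometric_le_lim => //; rewrite gtr0_norm.
- move=> x /= nF n _; apply: contrapT => nG; apply: nF.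
  exists n.+1 => // m /= nm Fm; apply: nG.
  by exists m => /=; [exact: ltnW|case: m nm Fm].
Qed.

End Probability.

(** * Cylinder events and windows with few drift sites *)

Lemma measurable_site (R : realType) (x : int) (B : set R) : measurable B ->
  measurable [set w : env R | B (w x)].
Proof. by move=> mB; apply: sub_sigma_algebra; exists x, B. Qed.

Definition cylinder (R : realType) (s : seq int) (B : int -> set R) : set (env R) :=
  [set w | forall x, x \in s -> B x (w x)].

Lemma measurable_cylinder (R : realType) s (B : int -> set R) :
  (forall x, measurable (B x)) -> measurable (cylinder s B).
Proof.
move=> mB; elim: s => [|x s IH].
  by rewrite (_ : cylinder _ _ = setT) //; apply/seteqP; split.
rewrite (_ : cylinder _ _ = [set w : env R | B x (w x)] `&` cylinder s B).
  by apply: measurableI => //; exact: measurable_site.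
apply/seteqP; split=> w /=.
  by move=> H; split=> [|y ys]; apply: H; rewrite inE ?eqxx ?ys ?orbT.
by move=> [H1 H2] y; rewrite inE => /predU1P[->|/H2].
Qed.

Section IndependentSites.
Variables (R : realType) (P : probability (env R) R).
Hypothesis indep : sites_independent P.

Lemma pr_cylinder s (B : int -> set R) : uniq s -> (forall x, measurable (B x)) ->
  pr P (cylinder s B) = \prod_(x <- s) pr P [set w | B x (w x)].
Proof.
move=> us mB; apply: EFin_inj; rewrite -prE; last exact: measurable_cylinder.
rewrite indep // -prodEFin; apply: eq_bigr => x _.
by rewrite prE //; exact: measurable_site.
Qed.

(** Merges constraints on two disjoint sets of sites into one family, so that an intersection of
    cylinders is again a cylinder and independence applies to it. *)
Definition glue (t : seq int) (C B : int -> set R) (x : int) : set R :=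
  if x \in t then C x else B x.

Lemma measurable_glue t (C B : int -> set R) : (forall x, measurable (C x)) ->
  (forall x, measurable (B x)) -> forall x, measurable (glue t C B x).
Proof. by move=> mC mB x; rewrite /glue; case: ifP. Qed.

Lemma cylinder_glue t s (C B : int -> set R) : (forall x, x \in s -> x \notin t) ->
  cylinder (t ++ s) (glue t C B) = cylinder t C `&` cylinder s B.
Proof.
move=> st; rewrite /glue; apply/seteqP; split=> w /=.
  move=> H; split=> x xs; have := H x; rewrite mem_cat xs ?orbT => /(_ isT) //.
  by rewrite ifN // st.
move=> [H1 H2] x; rewrite mem_cat; case: ifP => xt /=; first by move=> _; exact: H1.
exact: H2.
Qed.

Lemma pr_cylinderI t s (C B : int -> set R) : uniq t -> uniq s ->
  (forall x, x \in s -> x \notin t) ->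
  (forall x, measurable (C x)) -> (forall x, measurable (B x)) ->
  pr P (cylinder t C `&` cylinder s B) = pr P (cylinder t C) * pr P (cylinder s B).
Proof.
move=> ut us st mC mB; rewrite -cylinder_glue //.
rewrite pr_cylinder; last exact: measurable_glue.
- rewrite big_cat !pr_cylinder //=; congr (_ * _); rewrite !big_seq.
    by apply: eq_bigr => x xt; rewrite /glue xt.
  by apply: eq_bigr => x xs; rewrite /glue ifN // st.
- rewrite cat_uniq ut us andbT /=; apply/hasPn => x; exact: st.
Qed.

Hypothesis ident : sites_identically_distributed P.

Definition few_drifts (p : R) (x : int) (l K : nat) : set (env R) :=
  [set w | (\sum_(m < l) (p <= w (x + m%:Z))%R < K)%N].

Lemma few_driftsS p x l K : few_drifts p x l.+1 K.+1 =
  (few_drifts p x l K.+1 `&` [set w : env R | w (x + l%:Z) < p]) `|`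
  (few_drifts p x l K `&` [set w : env R | p <= w (x + l%:Z)]).
Proof.
apply/seteqP; split=> w; rewrite /few_drifts /= big_ord_recr /=.
  by case: (lerP p (w (x + l%:Z))) => _ H; [right|left]; split=> //; lia.
by case=> -[H]; [rewrite ltNge => /negbTE ->|move=> ->]; lia.
Qed.

Lemma few_drifts0 p x l : few_drifts p x l 0 = set0.
Proof. by apply/seteqP; split. Qed.

Lemma measurable_ge (p : R) : measurable [set y : R | p <= y].
Proof. by rewrite -set_itvcy; exact: measurable_itv. Qed.

Lemma measurable_lt (p : R) : measurable [set y : R | y < p].
Proof. by rewrite -set_itvNyo; exact: measurable_itv. Qed.

Lemma measurable_few_drifts p x l K : measurable (few_drifts p x l K).
Proof.
elim: l K => [|l IH] [|K]; rewrite ?few_drifts0 //.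
  rewrite (_ : few_drifts _ _ _ _ = setT) //; apply/seteqP; split=> // w _.
  by rewrite /few_drifts /= big_ord0.
rewrite few_driftsS; apply: measurableU; apply: measurableI => //.
  exact: (measurable_site _ (measurable_lt p)).
exact: (measurable_site _ (measurable_ge p)).
Qed.

Lemma cylinder1 (y : int) (C : set R) :
  cylinder [:: y] (fun=> C) = [set w : env R | C (w y)].
Proof.
apply/seteqP; split=> w /=; first by apply; rewrite mem_head.
by move=> H x; rewrite inE => /eqP ->.
Qed.

(* Exponential Chebyshev in disguise: [b] bounds the expectation of
   [s ^ (number of drift sites)] over one site. *)
Lemma pr_few_drifts_cylinder (p s b : R) : 0 < s <= 1 ->
  pr P [set w | w 0 < p] + s <= b ->
  forall x l K u (B : int -> set R), uniq u -> (forall y, measurable (B y)) ->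
  (forall y, y \in u -> x + l%:Z <= y) ->
  pr P (cylinder u B `&` few_drifts p x l K)
    <= pr P (cylinder u B) * ((s^-1) ^+ K * b ^+ l).
Proof.
move=> /andP[s0 s1] sb x; have a0 := pr_ge0 P [set w | w 0 < p].
have b0 : 0 <= b by lra.
have i0 K : 0 <= (s^-1) ^+ K by rewrite exprn_ge0 // invr_ge0 ltW.
(* Induction on the length of the window: its last site joins the cylinder on the right, which is
   why the statement carries one. *)
elim=> [|l IH] K u B uu mB uy.
  rewrite expr0 mulr1; case: K => [|K].
    by rewrite few_drifts0 setI0 pr_set0 expr0 mulr1 pr_ge0.
  apply: (@le_trans _ _ (pr P (cylinder u B))).
    apply: le_pr; last by move=> w [].
      by apply: measurableI; [exact: measurable_cylinder|exact: measurable_few_drifts].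
    exact: measurable_cylinder.
  by rewrite ler_peMr ?pr_ge0 // exprn_ege1 // invf_ge1.
case: K => [|K].
  by rewrite few_drifts0 setI0 pr_set0 mulr_ge0 ?pr_ge0 // mulr_ge0 // exprn_ge0.
have mF := measurable_few_drifts p x l.
have mu := measurable_cylinder u mB.
have step (C : set R) K' : measurable C ->
    measurable (cylinder u B `&` (few_drifts p x l K' `&` [set w : env R | C (w (x + l%:Z))])) /\
    pr P (cylinder u B `&` (few_drifts p x l K' `&` [set w : env R | C (w (x + l%:Z))]))
    <= pr P [set w | C (w 0)] * pr P (cylinder u B) * ((s^-1) ^+ K' * b ^+ l).
  move=> mC.
  have xu y : y \in u -> y \notin [:: x + l%:Z].
    by move=> /uy yl; rewrite inE; apply/eqP => yE; move: yl; rewrite yE; lia.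
  split.
    by do 2 apply: measurableI => //; exact: (measurable_site _ mC).
  rewrite -cylinder1 [few_drifts _ _ _ _ `&` _]setIC setIA.
  rewrite [cylinder u B `&` _]setIC -cylinder_glue //; apply: (le_trans (IH K' _ _ _ _ _)).
  - rewrite cat_uniq uu andbT /=; apply/hasPn => y; exact: xu.
  - exact: measurable_glue.
  - by move=> y; rewrite mem_cat inE => /orP[/eqP ->|/uy]; lia.
  - rewrite cylinder_glue // pr_cylinderI // cylinder1 (_ : pr P [set w | C (w (x + l%:Z))]
      = pr P [set w | C (w 0)]) //.
    by rewrite /pr (ident (x + l%:Z) 0 mC).
rewrite few_driftsS setIUr.
have [m1 H1] := step _ K.+1 (measurable_lt p).
have [m2 H2] := step _ K (measurable_ge p).
rewrite prU //; last first.
  by apply/seteqP; split=> // w [[_ [_ /= ?]] [_ [_ /= ?]]]; lra.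
apply: (le_trans (lerD H1 H2)).
have q1 : pr P [set w | p <= w 0] <= 1.
  by apply: pr_le1; exact: (measurable_site _ (measurable_ge p)).
(* Counting a drift site lowers the exponent of [s^-1] and so yields a factor [s]; the two cases for
   the last site then weigh at most [b] in total. *)
have E : (s^-1) ^+ K = s * (s^-1) ^+ K.+1 by rewrite exprS mulVKf // gt_eqF.
rewrite E (exprS b).
set Z := pr P (cylinder u B); set S := (s^-1) ^+ K.+1; set a := pr P _ in sb a0 *.
set q := pr P _ in q1 *.
have Z0 : 0 <= Z * (S * b ^+ l).
  by rewrite mulr_ge0 ?pr_ge0 // mulr_ge0 ?i0 // exprn_ge0.
rewrite (_ : _ + _ = Z * (S * b ^+ l) * (a + q * s)); last by ring.
rewrite [leRHS](_ : _ = Z * (S * b ^+ l) * b); last by ring.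
rewrite ler_wpM2l //; apply: le_trans sb.
by rewrite lerD2l ler_piMl // ltW.
Qed.

Lemma pr_few_drifts (p s b : R) x l K : 0 < s <= 1 ->
  pr P [set w | w 0 < p] + s <= b ->
  pr P (few_drifts p x l K) <= (s^-1) ^+ K * b ^+ l.
Proof.
move=> s01 sb.
have := @pr_few_drifts_cylinder p s b s01 sb x l K [::] (fun=> setT) isT.
rewrite (_ : cylinder [::] _ = setT); last by apply/seteqP; split.
rewrite setTI pr_setT mul1r; exact.
Qed.

End IndependentSites.

(** * Drift sites and fair stretches of a typical environment *)

Section Environment.
Variables (R : realType) (P : probability (env R) R).
Hypotheses (indep : sites_independent P) (ident : sites_identically_distributed P).
Hypothesis drift : P [set w : env R | 2^-1 <= w 0] = 1%E.
Variable alpha : R.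
Hypotheses (alphaE : P [set w : env R | w 0 = 2^-1] = alpha%:E)
  (alpha_itv : 0 < alpha < 1).

Lemma ae_sites (B : set R) : measurable B -> P [set w : env R | B (w 0)] = 1%E ->
  {ae P, forall w : env R, forall x, B (w x)}.
Proof.
move=> mB B1.
have H x : {ae P, forall w : env R, B (w x)}.
  apply: ae_of_probability1; first exact: (measurable_site x mB).
  by rewrite (ident x 0 mB).
have H1 := ae_foralln (fun n : nat => H n%:Z).
have H2 := ae_foralln (fun n : nat => H (- n%:Z)).
apply: filterS2 H1 H2 => w Hp Hn x.
case: (intP x) => [|n|n]; [exact: (Hp 0%N)|exact: Hp|exact: Hn].
Qed.

(** The events [w 0 < 2^-1 + 1 / (n + 2)] decrease to [w 0 <= 2^-1], which has probability [alpha]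
    because values below [2^-1] are null. Continuity from above gives [p]; the offset 2 keeps
    [p <= 1]. *)
Lemma pr_lt_near_half (e : R) : 0 < e ->
  exists2 p : R, 2^-1 < p <= 1 & pr P [set w | w 0 < p] < alpha + e.
Proof.
move=> e0.
pose A (n : nat) := [set w : env R | w 0 < 2^-1 + n.+2%:R^-1].
have mA n : measurable (A n) by exact: (measurable_site _ (measurable_lt _)).
have Acap : \bigcap_n A n = [set w : env R | w 0 <= 2^-1].
  apply/seteqP; split=> w /=; last first.
    by move=> w0 n _; rewrite /A /=; apply: le_lt_trans w0 _; rewrite ltrDl invr_gt0.
  move=> H; rewrite leNgt; apply/negP => w0.
  have d0 : 0 < w 0 - 2^-1 by rewrite subr_gt0.
  have := H (Num.truncn (w 0 - 2^-1)^-1) I; rewrite /A /= => H1.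
  have := truncnS_gt (w 0 - 2^-1)^-1; set t := Num.truncn _ in H1 *.
  rewrite -[X in _ < X]invrK ltf_pV2 ?posrE ?invr_gt0 // => H2.
  have : (t.+2%:R : R)^-1 <= t.+1%:R^-1 by rewrite lef_pV2 ?posrE // ler_nat.
  move=> H3; move: H1; rewrite -ltrBlDl => /lt_le_trans/(_ H3).
  by rewrite ltNge (ltW H2).
have mle : measurable [set w : env R | w 0 <= 2^-1].
  by rewrite -Acap; apply: bigcap_measurable.
have mge : measurable [set w : env R | 2^-1 <= w 0].
  exact: (measurable_site _ (measurable_ge _)).
have pE : pr P [set w | w 0 <= 2^-1] = alpha.
  rewrite (pr_split P mle mge).
  rewrite (_ : _ `&` _ = [set w : env R | w 0 = 2^-1]); last first.
    apply/seteqP; split=> w /=; first by move=> [? ?]; apply/eqP; rewrite eq_le; apply/andP.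
    by move=> ->.
  rewrite {1}/pr alphaE /= [X in _ + X](_ : _ = 0) ?addr0 //.
  apply/eqP; rewrite eq_le pr_ge0 andbT.
  apply: (@le_trans _ _ (pr P (~` [set w | 2^-1 <= w 0]))).
    apply: le_pr; [|exact: measurableC|by move=> w []].
    by apply: measurableI => //; exact: measurableC.
  by rewrite /pr probability_setC // drift subee.
have cvgA : pr P (A n) @[n --> \oo] --> alpha.
  have capE : P (\bigcap_n A n) = alpha%:E by rewrite Acap prE // pE.
  apply: (@fine_cvg _ _ _ _ (P \o A)); rewrite -capE.
  apply: nonincreasing_cvg_mu => //.
  - by rewrite -ge0_fin_numE // fin_num_measure.
  - by rewrite Acap.
  - move=> n m nm; apply/subsetPset => w; rewrite /A /= => /lt_le_trans; apply.
    by rewrite lerD2l lef_pV2 ?posrE // ler_nat.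
have [n _ Hn] : \forall n \near \oo, pr P (A n) < alpha + e.
  by apply: (cvgr_lt _ cvgA); rewrite ltrDl.
exists (2^-1 + n.+2%:R^-1); last exact: (Hn n (leqnn n)).
rewrite ltrDl invr_gt0 ltr0n /=.
have : (n.+2%:R : R)^-1 <= 2^-1 by rewrite lef_pV2 ?posrE // ler_nat.
by move: (n.+2%:R^-1) => y; lra.
Qed.

(** A single window fails with probability of order [b ^+ l] where [b < beta], and there are of
    order [beta^-1 ^+ l] windows, so the union bound is geometric with ratio [b / beta]. The
    threshold [p] is the same for every [K]. *)
Lemma ae_many_drifts (beta : R) : alpha < beta < 1 ->
  exists2 p : R, 2^-1 < p <= 1 & forall K : nat,
  {ae P, forall w : env R, \forall l \near \oo,
    forall x : int, (`|x|%N)%:R <= (beta^-1) ^+ l ->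
    (K <= \sum_(m < l) (p <= w (x + m%:Z))%R)%N}.
Proof.
move=> /andP[ab b1]; have /andP[a0 a1] := alpha_itv.
(* A quarter of the gap serves twice, as margin for [p] and as Chebyshev weight:
   [alpha + s + s = b]. *)
pose s := (beta - alpha) / 4; have s0 : 0 < s by rewrite /s; lra.
have [p p01 pp] := pr_lt_near_half s0.
exists p => // K.
have b0 : 0 < beta by lra.
pose N l := Num.truncn ((beta^-1) ^+ l).
pose b := (alpha + beta) / 2.
pose F l := [set w : env R | exists2 i, (i < (2 * N l).+1)%N &
  few_drifts p (i%:Z - (N l)%:Z) l K w].
have b'0 l : 0 <= (beta^-1) ^+ l by rewrite exprn_ge0 // invr_ge0 ltW.
have b'1 l : 1 <= (beta^-1) ^+ l by rewrite exprn_ege1 // invf_ge1 // ltW.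
have F1 l := @pr_bigU_le _ _ R P (fun i => few_drifts p (i%:Z - (N l)%:Z) l K)
  (2 * N l).+1 ((s^-1) ^+ K * b ^+ l)
  (fun i => measurable_few_drifts p _ l K).
have sb : pr P [set w | w 0 < p] + s <= b by rewrite /b; move: pp; rewrite /s; lra.
have s01 : 0 < s <= 1 by rewrite s0 /= /s; lra.
have {}F1 l := F1 l (fun i => pr_few_drifts indep ident _ l K s01 sb).
have : {ae P, forall w, \forall l \near \oo, ~ F l w}.
  apply: (@borel_cantelli_geometric _ _ R P F (3 * (s^-1) ^+ K) (b / beta)).
  - by move=> l; have [] := F1 l.
  - by rewrite mulr_ge0 // exprn_ge0 // invr_ge0 ltW.
  - rewrite divr_gt0 //=; last by rewrite /b; lra.
    by rewrite ltr_pdivrMr // mul1r /b; lra.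
  - move=> l l0; have [_ H] := F1 l; apply: (le_trans H).
    rewrite [leRHS](_ : _ = 3 * (beta^-1) ^+ l * ((s^-1) ^+ K * b ^+ l)); last first.
      by rewrite exprMn; move: (_^-1 ^+ l) (_^-1 ^+ K) => ? ?; ring.
    rewrite ler_wpM2r //.
      by rewrite mulr_ge0 // exprn_ge0 ?invr_ge0 ?(ltW s0) // /b; lra.
    have : (N l)%:R <= (beta^-1) ^+ l by rewrite /N truncn_le.
    rewrite -natr1 natrM; have := b'1 l; lra.
apply: filterS => w; apply: filterS => l nF x xl.
rewrite leqNgt; apply/negP => few; apply: nF.
have xN : (`|x| <= N l)%N by rewrite /N truncn_ge_nat.
exists `|(x + (N l)%:Z)%R|%N; first by lia.
by rewrite (_ : _ - _ = x) //; lia.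
Qed.

Definition block (l j : nat) : seq int := [seq (j * l + i)%N%:Z | i <- iota 0 l].

Lemma uniq_block l j : uniq (block l j).
Proof. by rewrite map_inj_uniq ?iota_uniq // => a b /= []; lia. Qed.

Lemma mem_block l j (x : int) :
  x \in block l j -> (j * l)%N%:Z <= x < (j * l + l)%N%:Z.
Proof. by move=> /mapP[i]; rewrite mem_iota => ? ->; lia. Qed.

Definition fair_block (l j : nat) : set (env R) :=
  cylinder (block l j) (fun=> [set 2^-1]).

Definition no_fair_block (l M : nat) : set (env R) :=
  [set w | forall j, (j < M)%N -> ~ fair_block l j w].

Lemma measurable_fair_block l j : measurable (fair_block l j).
Proof. by apply: measurable_cylinder. Qed.

Lemma no_fair_blockS l M :
  no_fair_block l M.+1 = no_fair_block l M `&` ~` fair_block l M.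
Proof.
apply/seteqP; split=> w /=.
  by move=> H; split=> [j jM|]; apply: H; lia.
by move=> [H1 H2] j; rewrite ltnS leq_eqVlt => /predU1P[->|/H1].
Qed.

Lemma measurable_no_fair_block l M : measurable (no_fair_block l M).
Proof.
elim: M => [|M IH].
  by rewrite (_ : no_fair_block _ _ = setT) //; apply/seteqP; split.
rewrite no_fair_blockS; apply: measurableI => //.
by apply: measurableC; exact: measurable_fair_block.
Qed.

Lemma pr_fair_block l j : pr P (fair_block l j) = alpha ^+ l.
Proof.
rewrite /fair_block pr_cylinder ?uniq_block //.
rewrite (eq_bigr (fun=> alpha)).
  by rewrite big_const_seq count_predT size_map size_iota iter_mulr_1.
by move=> x _; rewrite /pr (ident x 0 (@measurable_set1 R 2^-1)) alphaE.
Qed.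

(** That a block is not fair is no cylinder event, so its probability comes by subtraction: the fair
    block is glued to the cylinder, and the induction hypothesis applies with and without it. *)
Lemma pr_no_fair_block_cylinder l M s (B : int -> set R) :
  uniq s -> (forall x, measurable (B x)) ->
  (forall x, x \in s -> (M * l)%N%:Z <= x) ->
  pr P (cylinder s B `&` no_fair_block l M)
    = pr P (cylinder s B) * (1 - alpha ^+ l) ^+ M.
Proof.
elim: M s B => [|M IH] s B us mB sM.
  rewrite expr0 mulr1 (_ : no_fair_block _ _ = setT) ?setIT //.
  by apply/seteqP; split.
have IHs : pr P (cylinder s B `&` no_fair_block l M)
    = pr P (cylinder s B) * (1 - alpha ^+ l) ^+ M.
  by apply: IH => // x /sM; lia.
have m1 := measurable_cylinder s mB.
have m2 := measurable_no_fair_block l M.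
have m3 := measurable_fair_block l M.
have := pr_split P (measurableI _ _ m1 m2) m3.
rewrite -[_ `&` _ `&` ~` _]setIA -no_fair_blockS IHs.
have st x : x \in s -> x \notin block l M.
  by move=> /sM xM; apply/negP => /mem_block; lia.
have -> : pr P (cylinder s B `&` no_fair_block l M `&` fair_block l M)
    = alpha ^+ l * pr P (cylinder s B) * (1 - alpha ^+ l) ^+ M.
  rewrite setIC setIA -cylinder_glue // IH.
  - by rewrite cylinder_glue // pr_cylinderI ?uniq_block // -/(fair_block l M) pr_fair_block.
  - rewrite cat_uniq uniq_block us andbT /=; apply/hasPn => x; exact: st.
  - exact: measurable_glue.
  - by move=> x; rewrite mem_cat => /orP[/mem_block|/sM]; lia.
rewrite exprS; set X := _ ^+ M; set Y := pr P (cylinder _ _); set Z := pr P _.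
by move=> E; apply: (addrI (alpha ^+ l * Y * X)); rewrite -E; ring.
Qed.

(** Among about [l * alpha^-1 ^+ l] disjoint blocks of length [l], all fail to be fair with
    probability at most [expR (- l)], by [1 - y <= expR (- y)]; this is summable. *)
Lemma ae_fair_run :
  {ae P, forall w : env R, \forall l \near \oo,
    exists2 a : nat, a%:R <= l%:R ^+ 2 * (alpha^-1) ^+ l &
      forall i, (i < l)%N -> w (a%:Z + i%:Z) = 2^-1}.
Proof.
have /andP[a0 a1] := alpha_itv.
pose t l := Num.truncn (l%:R * (alpha^-1) ^+ l).
have ai l : 0 < (alpha^-1) ^+ l by rewrite exprn_gt0 // invr_gt0.
have q0 l : 0 <= l%:R * (alpha^-1) ^+ l by rewrite mulr_ge0 // ltW.
have : {ae P, forall w, \forall l \near \oo, ~ no_fair_block l (t l).+1 w}.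
  apply: (@borel_cantelli_geometric _ _ R P _ 1 (expR (- 1))).
  - by move=> l; exact: measurable_no_fair_block.
  - by [].
  - by rewrite expR_gt0 expR_lt1 ltrN10.
  - move=> l l0; rewrite mul1r.
    have := @pr_no_fair_block_cylinder l (t l).+1 [::] (fun=> setT) isT.
    rewrite (_ : cylinder [::] _ = setT); last by apply/seteqP; split.
    rewrite setTI pr_setT mul1r => -> //.
    have a01 : 0 <= 1 - alpha ^+ l by rewrite subr_ge0 exprn_ile1 // ltW.
    apply: (@le_trans _ _ (expR (- alpha ^+ l) ^+ (t l).+1)).
      by apply: lerXn2r; rewrite ?nnegrE ?expR_ge0 // expR_ge1Dx.
    rewrite -!expRM_natr ler_expR mulN1r mulNr lerN2.
    have H : l%:R * (alpha^-1) ^+ l <= (t l).+1%:R by rewrite ltW // truncnS_gt.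
    apply: le_trans (ler_wpM2l (exprn_ge0 l (ltW a0)) H).
    by rewrite mulrCA exprVn divff ?mulr1 // gt_eqF // exprn_gt0.
apply: filterS => w; apply: filterS => l nF.
have [j jt fj] : exists2 j, (j < (t l).+1)%N & fair_block l j w.
  by apply: contrapT => H; apply: nF => j jt fj; apply: H; exists j.
exists (j * l)%N.
  rewrite natrM mulrC expr2 -mulrA ler_wpM2l //.
  have : (t l)%:R <= l%:R * (alpha^-1) ^+ l by rewrite /t truncn_le.
  by apply: le_trans; rewrite ler_nat -ltnS.
move=> i il; apply: (fj _); rewrite -PoszD.
by apply/mapP; exists i => //; rewrite mem_iota.
Qed.

End Environment.

(** * The return probability of the quenched walk *)

Section MarkovProperty.
Variables (R : realType) (w : env R) (d : measure_display) (Om : measurableType d).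
Variables (Q : probability Om R) (X : nat -> Om -> int).
Hypothesis walk : quenched_walk w Q X.

Let past n (x : nat -> int) : set Om :=
  [set o | forall i, (i <= n)%N -> X i o = x i].

Lemma measurable_past n x : measurable (past n x).
Proof.
rewrite (_ : past n x = \bigcap_(i in [set i | (i <= n)%N]) [set o | X i o = x i]) //.
by apply: bigcap_measurable => [|i _]; [exists 0%N|case: walk].
Qed.

(** Induction on [k] over all pasts at once: the next step extends the past by [x n + 1] or
    [x n - 1], which produces the transition operator. *)
Lemma pr_past_return k n (x : nat -> int) :
  pr Q (past n x `&` [set o | X (n + k)%N o = 0])
    = pr Q (past n x) * return_prob w k (x n).
Proof.
have [mX _ markov] := walk.
elim: k n x => [|k IH] n x.
  rewrite addn0 /=; have [x0|x0] := eqVneq (x n) 0.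
    rewrite mulr1; congr (pr Q _); apply/seteqP; split=> o /=; first by case.
    by move=> H; split=> //; rewrite (H n).
  rewrite mulr0 (_ : _ `&` _ = set0) ?pr_set0 //.
  apply/seteqP; split=> // o /= [H Xn]; move: x0.
  by rewrite -(H n) // Xn eqxx.
pose next y i := if (i <= n)%N then x i else y.
have pastS y : past n.+1 (next y) = past n x `&` [set o | X n.+1 o = y].
  apply/seteqP; split=> o /=.
    move=> H; split=> [i il|]; first by rewrite (H i (leqW il)) /next il.
    by rewrite (H n.+1) // /next ltnn.
  move=> [H1 H2] i; rewrite leq_eqVlt => /predU1P[->|].
    by rewrite /next ltnn.
  by rewrite ltnS => il; rewrite H1 // /next il.
have mP := measurable_past n x.
have mZ := mX (n + k.+1)%N 0.
have step y : pr Q (past n x `&` [set o | X n.+1 o = y]) = pr Q (past n x) * jump w (x n) y.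
  have /= := markov n x y; rewrite -/(past n x) => /(congr1 fine).
  by rewrite fineM // fin_num_measure.
have stepk y : pr Q (past n x `&` [set o | X (n + k.+1)%N o = 0] `&` [set o | X n.+1 o = y])
    = pr Q (past n x) * jump w (x n) y * return_prob w k y.
  by rewrite setIAC -pastS addnS -addSn IH pastS step /next ltnn.
set U := [set o | X n.+1 o = x n + 1].
set D := [set o | X n.+1 o = x n - 1].
have mU : measurable U by exact: mX.
have mD : measurable D by exact: mX.
have DU (A : set Om) : A `&` ~` U `&` D = A `&` D.
  apply/seteqP; split=> o /=; first by move=> [[]].
  move=> [Ao Do]; split=> //; split=> //; rewrite /U /= => Uo.
  by move: Do; rewrite /D /= Uo; lia.
have mI (A B : set Om) : measurable A -> measurable B -> measurable (A `&` B).
  exact: measurableI.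
have mPU : measurable (past n x `&` ~` U) by apply: mI => //; exact: measurableC.
have mPZ := mI _ _ mP mZ.
have mPZU : measurable (past n x `&` [set o | X (n + k.+1)%N o = 0] `&` ~` U).
  by apply: mI => //; exact: measurableC.
have jU : jump w (x n) (x n + 1) = w (x n) by rewrite /jump eqxx.
have jD : jump w (x n) (x n - 1) = 1 - w (x n).
  by rewrite /jump ifN ?eqxx //; apply/eqP; lia.
(* The two neighbours carry the whole jump probability, so any other move is null. *)
have rest : pr Q (past n x `&` ~` U `&` ~` D) = 0.
  have := pr_split Q mP mU; rewrite (pr_split Q mPU mD) DU !step jU jD; lra.
have restZ : pr Q (past n x `&` [set o | X (n + k.+1)%N o = 0] `&` ~` U `&` ~` D) = 0.
  apply/eqP; rewrite eq_le pr_ge0 andbT -rest; apply: le_pr.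
  - by apply: mI => //; exact: measurableC.
  - by apply: mI => //; exact: measurableC.
  - by move=> o [[[]]].
rewrite (pr_split Q mPZ mU) (pr_split Q mPZU mD) DU restZ !stepk jU jD.
rewrite [return_prob w k.+1 _]/= /walk_step -/(return_prob w k); ring.
Qed.

Lemma quenched_return_prob n :
  fine (Q [set o | X n o = 0]) = return_prob w n 0.
Proof.
have [mX X0 _] := walk.
have p0 : past 0 (fun=> 0) = [set o | X 0%N o = 0].
  apply/seteqP; split=> o /=; first exact.
  by move=> H i; rewrite leqn0 => /eqP ->.
have := pr_past_return n 0 (fun=> 0); rewrite add0n p0.
have P1 : pr Q [set o | X 0%N o = 0] = 1 by rewrite /pr X0.
rewrite P1 mul1r => <-; rewrite -/(pr Q _).
rewrite (pr_split Q (mX n 0) (mX 0%N 0)) setIC.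
rewrite [X in _ + X](_ : _ = 0) ?addr0 //.
apply/eqP; rewrite eq_le pr_ge0 andbT.
apply: (@le_trans _ _ (pr Q (~` [set o | X 0%N o = 0]))).
  apply: le_pr; [|exact: measurableC|by move=> o []].
  by apply: measurableI => //; exact: measurableC.
by rewrite /pr probability_setC // X0 subee.
Qed.

End MarkovProperty.

(** * Asymptotics *)

Lemma near_ln_ge (R : realType) (C : R) : \forall n \near \oo, C <= ln (n%:R : R).
Proof.
exists (Num.truncn (expR C)).+1 => // n /= nC.
have n0 : 0 < n%:R :> R by rewrite ltr0n; lia.
rewrite -[leLHS]expRK ler_ln ?posrE ?expR_gt0 //.
by apply: le_trans (ltW (truncnS_gt _)) _; rewrite ler_nat.
Qed.

(** Uses [cos theta <= 1 - y <= expR (- y)] for [y = theta ^+ 2 / 2 * (1 - theta ^+ 2 / 4)]. *)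
Lemma lnX_le_upper (R : realType) (rho theta : R) (n : nat) :
  0 < rho -> rho <= cos theta ^+ (2 * n) -> 0 <= theta <= pi / 2 ->
  ln rho <= - (n%:R * (theta ^+ 2 * (1 - theta ^+ 2 / 4))).
Proof.
move=> rho0 rhole th; have pi0 := pi_gt0 R; have /andP[th0 thpi] := th.
have c0 : 0 <= cos theta by apply: cos_ge0_pihalf; apply/andP; split; lra.
have c1 := cos_le_quartic th.
rewrite -[leRHS]expRK ler_ln ?posrE ?expR_gt0 //.
apply: (le_trans rhole).
rewrite (_ : - _ = - (theta ^+ 2 / 2 * (1 - theta ^+ 2 / 4)) * (2 * n)%:R); last first.
  by rewrite natrM; move: (theta ^+ 2) => y; field.
rewrite expRM_natr; apply: lerXn2r; rewrite ?nnegrE ?expR_ge0 //.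
by apply: (le_trans c1); exact: expR_ge1Dx.
Qed.

(** With [u = theta ^+ 2 / 2 <= 1 - r], one has [- ln (cos theta) <= 1 / cos theta - 1 <= u / (1 -
    u) <= u / r]. *)
Lemma ln_cos_ge (R : realType) (r theta : R) : 0 < r < 1 -> 0 <= theta <= 1 - r ->
  0 < cos theta /\ - (theta ^+ 2 / 2 / r) <= ln (cos theta).
Proof.
move=> /andP[r0 r1] /andP[th0 thr].
have pi2 := pi_ge2 R.
have c1 : 1 - theta ^+ 2 / 2 <= cos theta.
  by apply: cos_ge_quadratic; apply/andP; split; lra.
have u1 : theta ^+ 2 / 2 <= 1 - r by nra.
have u0 : 0 <= theta ^+ 2 / 2 by rewrite divr_ge0 // exprn_ge0.
move: (theta ^+ 2 / 2) u0 u1 c1 => u u0 u1 c1.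
have c0 : 0 < cos theta by lra.
split=> //; rewrite lerNl -lnV ?posrE //.
apply: (@le_trans _ _ ((cos theta)^-1 - 1)).
  rewrite -[X in ln X](addrNK 1) addrC le_ln1Dx // ltrBrDr addrC subrr.
  by rewrite invr_gt0.
have : (cos theta)^-1 <= (1 - u)^-1 by rewrite lef_pV2 ?posrE //; lra.
have : (1 - u)^-1 - 1 <= u / r.
  rewrite (_ : _ - 1 = u / (1 - u)); last by field; lra.
  by rewrite ler_wpM2l // lef_pV2 ?posrE //; lra.
lra.
Qed.

(** The term of degree 5 in the exponential series wins; 120 is its factorial. *)
Lemma expR_ge_pow4 (R : realType) (A b : R) : 0 <= A -> 0 < b ->
  exists C : R, forall L, C <= L -> A * L ^+ 4 <= expR (b * L).
Proof.
move=> A0 b0; exists (Num.max 0 (A * 120 / b ^+ 5)) => L.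
rewrite ge_max => /andP[L0 LA].
have bL : 0 <= b * L by rewrite mulr_ge0 // ltW.
apply: le_trans (expR_ge1Dxn 4 bL).
apply: (@le_trans _ _ ((b * L) ^+ 5 / 5`!%:R)); last by rewrite lerDr.
rewrite (_ : 5`! = 120)%N // ler_pdivlMr ?ltr0n // exprMn.
move: LA; rewrite ler_pdivrMr ?exprn_gt0 // => LA.
rewrite (_ : A * _ * _ = A * 120 * L ^+ 4); last by ring.
rewrite (_ : b ^+ 5 * _ = L * b ^+ 5 * L ^+ 4); last by ring.
by rewrite ler_wpM2r // exprn_ge0.
Qed.

(** [g] stands for [- ln alpha], and [r], later close to 1, absorbs all errors. Windows of length
    [l] near [ln n / (r * g)] are controlled throughout [[-2n, 2n]], and [return_prob_le] applies
    with [M = r * (pi / 2)]. *)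
Lemma return_rate_upper (R : realType) (w : int -> R) (g r c p q : R) (K l0 : nat) :
  0 < g -> 0 < r < 1 -> (forall x, 0 < w x < 1) -> (forall x, 2^-1 <= w x) ->
  0 < c -> (forall x, c <= w x <= 1 - c) -> 2^-1 <= p <= 1 ->
  q = 1 - (2 * p - 1) * cos (r * (pi / 2)) ^+ 2 -> q ^+ K <= 1 - r ->
  (forall l, (l0 <= l)%N -> forall x : int, (`|x|%N)%:R <= expR (r * g) ^+ l ->
    (K <= \sum_(m < l) (p <= w (x + m%:Z))%R)%N) ->
  \forall n \near \oo,
    ln n%:R ^+ 2 / n%:R * ln (return_prob w (2 * n) 0)
      <= - (r ^+ 9 * (pi * g / 2) ^+ 2).
Proof.
move=> g0 /andP[r0 r1] w01 whalf c0 wc p01 qE qK drifts.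
have pi0 := pi_gt0 R.
(* [C1] ensures [l0 <= l], [C2] absorbs the rounding of [l] and the 2 in [2 * n], [C3] keeps [theta]
   below [pi / 2] and [1 - r]. *)
pose C1 := r * g * l0%:R.
pose C2 := (ln 2 + g) / (1 - r).
pose C3 := g + 1 + pi * g / 2 / (1 - r).
near=> n.
have LC1 : C1 <= ln (n%:R : R) by near: n; exact: near_ln_ge.
have LC2 : C2 <= ln (n%:R : R) by near: n; exact: near_ln_ge.
have LC3 : C3 <= ln (n%:R : R) by near: n; exact: near_ln_ge.
have n0 : (0 < n)%N by near: n; exists 1%N.
have n0R : 0 < n%:R :> R by rewrite ltr0n.
set L := ln (n%:R : R) in LC1 LC2 LC3 *.
have rg0 : 0 < r * g by rewrite mulr_gt0.
have r'0 : 0 < 1 - r by rewrite subr_gt0.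
have ln20 : 0 <= ln (2 : R) by rewrite ln_ge0 // ler1n.
have s0 : 0 < pi * g / 2 by rewrite divr_gt0 // mulr_gt0.
have s1 : 0 < pi * g / 2 / (1 - r) by rewrite divr_gt0.
have Lg : g <= L by apply: le_trans LC3; rewrite /C3 -addrA lerDl addr_ge0 // ltW.
have L0 : 0 < L by lra.
pose t := (L + ln 2) / (r * g).
have t0 : 0 <= t by rewrite divr_ge0 ?(ltW rg0) //; lra.
pose l := (Num.truncn t).+1.
have tl : t <= l%:R by rewrite ltW // truncnS_gt.
have lt1 : l%:R <= t + 1.
  by rewrite -natr1 lerD2r truncn_le.
have ll0 : (l0 <= l)%N.
  rewrite -(ler_nat R); apply: le_trans tl; rewrite /t ler_pdivlMr // mulrC.
  by move: LC1; rewrite /C1; lra.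
(* Of the four factors [r], two offset [l <= L / (r ^+ 2 * g)], one the loss in [1 - q ^+ K >= r],
   one the factor in [M]. *)
pose theta := r ^+ 4 * (pi * g / 2) / L.
have r40 : 0 < r ^+ 4 by rewrite exprn_gt0.
have r41 : r ^+ 4 <= 1 by rewrite exprn_ile1 // ltW.
have th0 : 0 < theta by rewrite /theta divr_gt0 // mulr_gt0.
have thL : theta * L = r ^+ 4 * (pi * g / 2) by rewrite /theta divfK // gt_eqF.
have lL : l%:R <= L / (r ^+ 2 * g).
  apply: (le_trans lt1); rewrite ler_pdivlMr ?mulr_gt0 ?exprn_gt0 //.
  rewrite (_ : (t + 1) * _ = t * (r * g) * r + r * (r * g)); last by ring.
  rewrite divfK ?gt_eqF //.
  have H : ln 2 + g <= L * (1 - r) by move: LC2; rewrite /C2 ler_pdivrMr.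
  have : r * (r * g) <= g.
    by rewrite mulrA ler_piMl ?(ltW g0) // mulr_ile1 ?ltW.
  have : ln 2 * r <= ln (2 : R) by rewrite ler_piMr // ltW.
  lra.
have lth : l%:R * theta <= (1 - q ^+ K) * (r * (pi / 2)).
  apply: (@le_trans _ _ (r * (r * (pi / 2)))); last first.
    by rewrite ler_wpM2r; [|rewrite mulr_ge0 ?divr_ge0 ?ltW|lra].
  apply: (le_trans (ler_wpM2r (ltW th0) lL)).
  rewrite (_ : L / _ * theta = theta * L / (r ^+ 2 * g)); last by ring.
  rewrite thL (_ : _ / _ = r * (r * (pi / 2))) //.
  by field; rewrite !gt_eqF.
have thpi : theta <= pi / 2.
  rewrite -(ler_pM2r L0) thL.
  apply: (@le_trans _ _ (pi * g / 2)); first by rewrite ler_piMl // ltW.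
  by rewrite mulrAC ler_pM2l ?divr_gt0.
have r'pi : 0 <= r * (pi / 2) < pi / 2.
  by rewrite mulr_ge0 ?divr_ge0 ?ltW //= gtr_pMl // divr_gt0.
have := @return_prob_le R w p (r * (pi / 2)) q theta l K n w01 whalf p01 r'pi qE
  (ltW th0) isT lth.
have NX : (2 * n)%:R <= expR (r * g) ^+ l.
  rewrite -expRM_natr natrM -[leLHS]lnK ?posrE ?mulr_gt0 // ler_expR lnM ?posrE //.
  by rewrite addrC -/L mulrC -ler_pdivrMr.
move=> H.
have {}H : return_prob w (2 * n) 0 <= cos theta ^+ (2 * n).
  by apply: H => x xn; apply: drifts => //; apply: le_trans NX; rewrite ler_nat.
(* Taking logarithms requires positivity, which a single path from the origin back to it
   provides. *)
have rho0 : 0 < return_prob w (2 * n) 0.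
  apply: lt_le_trans (return_prob_ge_exp w01 c0 wc _ _) => //.
    by rewrite exprn_gt0.
  by rewrite absz0 add0n oddM.
have th01 : 0 <= theta <= pi / 2 by rewrite ltW.
have lnle := lnX_le_upper rho0 H th01.
have Ln0 : 0 <= L ^+ 2 / n%:R by rewrite divr_ge0 // exprn_ge0 // ltW.
apply: (le_trans (ler_wpM2l Ln0 lnle)).
rewrite (_ : _ * - _ = - ((theta * L) ^+ 2 * (1 - theta ^+ 2 / 4))); last first.
  by move: (theta ^+ 2 / 4) => y; field; rewrite gt_eqF.
rewrite lerN2 thL [(r ^+ 4 * _) ^+ 2]exprMn -exprM.
have thr : theta <= 1 - r.
  rewrite -(ler_pM2r L0) thL.
  apply: (@le_trans _ _ (pi * g / 2)); first by rewrite ler_piMl // ltW.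
  by rewrite [leRHS]mulrC -ler_pdivrMr //; apply: le_trans LC3; rewrite /C3 lerDr addr_ge0 // ltW.
have rth : r <= 1 - theta ^+ 2 / 4.
  by move: th0 thr r0; clear; nra.
have A0 : 0 <= (pi * g / 2) ^+ 2 by rewrite exprn_ge0 // ltW.
have r80 : 0 <= r ^+ 8 by rewrite exprn_ge0 // ltW.
(* Eight factors [r] come from [theta ^+ 2], the ninth from the quartic correction. *)
rewrite exprSr mulrAC ler_wpM2l //.
by rewrite mulr_ge0.
Unshelve. all: by end_near. Qed.

(** A fair stretch of length [l] near [r * ln n / g] lies within distance [n ^ r] up to powers of
    [ln n]; after scaling, the journey costs at most [1 - r] and the stay gives the main term. *)
Lemma return_rate_lower (R : realType) (w : int -> R) (g r c : R) (l0 : nat) :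
  0 < g -> 0 < r < 1 -> (forall x, 0 < w x < 1) -> (forall x, 2^-1 <= w x) ->
  0 < c -> (forall x, c <= w x <= 1 - c) ->
  (forall l, (l0 <= l)%N -> exists2 a : nat, a%:R <= l%:R ^+ 2 * expR g ^+ l &
      forall i, (i < l)%N -> w (a%:Z + i%:Z) = 2^-1) ->
  \forall n \near \oo,
    - ((pi * g / 2) ^+ 2 / r ^+ 5) - (1 - r)
      <= ln n%:R ^+ 2 / n%:R * ln (return_prob w (2 * n) 0).
Proof.
move=> g0 /andP[r0 r1] w01 whalf c0 wc runs.
have pi0 := pi_gt0 R.
have r'0 : 0 < 1 - r by rewrite subr_gt0.
have c1 : c < 1 by have /andP[] := wc 0; have := whalf 0; lra.
have lnc : 0 < - ln c by rewrite oppr_gt0 ln_lt0 // c0.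
(* Comes from [2 * a + l <= 3 * (l ^+ 2 * expR g ^+ l)] and [l <= L / g]. *)
pose S := 3 / g ^+ 2.
have S0 : 0 < S by rewrite divr_gt0 // exprn_gt0.
(* [Ca] makes the scaled cost of the journey at most [1 - r]; [Cb] makes the journey fit into
   [2 * n] steps. *)
have [|Ca HCa] := @expR_ge_pow4 R (S * (- ln c) / (1 - r)) (1 - r) _ r'0.
  exact: divr_ge0 (mulr_ge0 (ltW S0) (ltW lnc)) (ltW r'0).
have [Cb HCb] := @expR_ge_pow4 R S (1 - r) (ltW S0) r'0.
pose s := pi * g / 2.
have s0 : 0 < s by rewrite /s divr_gt0 // mulr_gt0.
have rr0 : 0 < r ^+ 2 * (1 - r) by rewrite mulr_gt0 // exprn_gt0.
near=> n.
have LC1 : 1 <= ln (n%:R : R) by near: n; exact: near_ln_ge.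
have LC2 : g / (r * (1 - r)) <= ln (n%:R : R) by near: n; exact: near_ln_ge.
have LC3 : (l0%:R + 1) * g / r ^+ 2 <= ln (n%:R : R) by near: n; exact: near_ln_ge.
have LC4 : s / (r ^+ 2 * (1 - r)) <= ln (n%:R : R) by near: n; exact: near_ln_ge.
have LCa : Ca <= ln (n%:R : R) by near: n; exact: near_ln_ge.
have LCb : Cb <= ln (n%:R : R) by near: n; exact: near_ln_ge.
have n0 : (0 < n)%N by near: n; exists 1%N.
have n0R : 0 < n%:R :> R by rewrite ltr0n.
have nE : n%:R = expR (ln (n%:R : R)) by rewrite lnK.
set L := ln (n%:R : R) in LC1 LC2 LC3 LC4 LCa LCb nE *.
have L0 : 0 < L by lra.
pose t := r * L / g.
have t0 : 0 <= t by rewrite divr_ge0 ?mulr_ge0 ?ltW.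
pose l := Num.truncn t.
have lt : l%:R <= t by rewrite truncn_le.
have tl : t - 1 <= l%:R by rewrite lerBlDr natr1 ltW // truncnS_gt.
have rl : r ^+ 2 * L / g <= l%:R.
  apply: le_trans tl; rewrite ler_pdivrMr // /t mulrBl divfK ?gt_eqF //.
  have : g <= L * (r * (1 - r)) by rewrite -ler_pdivrMr // mulr_gt0.
  rewrite expr2; lra.
have l1 : l0%:R + 1 <= l%:R :> R.
  apply: le_trans rl; rewrite ler_pdivlMr //.
  by rewrite [leRHS]mulrC -ler_pdivrMr ?exprn_gt0.
have ll0 : (l0 <= l)%N by rewrite -(ler_nat R); lra.
have lgt0 : (0 < l)%N by rewrite -(ltr_nat R); have := ler0n R l0; lra.
have lR0 : 0 < l%:R :> R by rewrite ltr0n.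
have lR1 : 1 <= l%:R :> R by rewrite ler1n.
have [a al fair] := runs l ll0.
have egl : expR g ^+ l <= expR (r * L).
  rewrite -expRM_natr ler_expR.
  by have := ler_wpM2l (ltW g0) lt; rewrite /t mulrC [g * _]mulrC divfK // gt_eqF.
have eg1 : 1 <= expR g ^+ l by rewrite exprn_ege1 // -expR0 ler_expR ltW.
have len : (2 * a + l)%:R <= S * L ^+ 2 * expR (r * L).
  apply: (@le_trans _ _ (3 * (l%:R ^+ 2 * expR g ^+ l))).
    have : l%:R <= l%:R ^+ 2 * expR g ^+ l.
      apply: (@le_trans _ _ (l%:R ^+ 2)); first by rewrite expr2 ler_peMl // ltW.
      by rewrite ler_peMr // exprn_ge0 // ltW.
    move=> H; have := lerD (ler_wpM2l (ler0n R 2) al) H; rewrite -natrM -natrD.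
    by move/le_trans; apply; rewrite -[X in _ + X]mul1r -mulrDl natr1.
  rewrite [leRHS](_ : _ = 3 * ((L / g) ^+ 2 * expR (r * L))); last first.
    by rewrite /S; field; rewrite gt_eqF.
  rewrite ler_pM2l //.
  apply: ler_pM; rewrite ?exprn_ge0 ?expR_ge0 ?(ltW lR0) //.
  apply: lerXn2r; rewrite ?nnegrE ?(ltW lR0) ?divr_ge0 ?(ltW L0) ?(ltW g0) //.
  apply: (le_trans lt); rewrite /t ler_wpM2r ?invr_ge0 ?(ltW g0) //.
  by rewrite ler_piMl // ltW.
have nsplit : n%:R = expR (r * L) * expR ((1 - r) * L) :> R.
  by rewrite nE -expRD; congr expR; ring.
have er0 : 0 < expR (r * L) by exact: expR_gt0.
have L21 : 1 <= L ^+ 2 by rewrite exprn_ege1.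
have aln : (2 * a + l <= 2 * n)%N.
  rewrite -(ler_nat R); apply: (le_trans len).
  apply: (@le_trans _ _ n%:R); last by rewrite ler_nat leq_pmull.
  rewrite nsplit mulrC ler_pM2l //; apply: le_trans (HCb _ LCb).
  by rewrite ler_pM2l // (exprD L 2 2) ler_peMr // exprn_ge0 // ltW.
have := return_prob_ge w01 whalf c0 wc lgt0 aln fair.
set theta := pi / 2 / l%:R => Hge.
have th0 : 0 <= theta by rewrite /theta !divr_ge0 // ltW.
have thL : theta * (r ^+ 2 * L) <= s.
  rewrite /theta mulrAC ler_pdivrMr //.
  rewrite [leRHS](_ : _ = pi / 2 * (l%:R * g)); last by rewrite /s; ring.
  by rewrite ler_wpM2l ?divr_ge0 ?(ltW pi0) // -ler_pdivrMr.
have thr : theta <= 1 - r.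
  rewrite -(@ler_pM2r _ (r ^+ 2 * L)) ?mulr_gt0 ?exprn_gt0 //.
  apply: (le_trans thL).
  rewrite [leRHS](_ : _ = L * (r ^+ 2 * (1 - r))); last by ring.
  by rewrite -ler_pdivrMr.
have r01 : 0 < r < 1 by rewrite r0.
have th01 : 0 <= theta <= 1 - r by rewrite th0.
have [ct lct] := ln_cos_ge r01 th01.
have X0 : 0 < c ^+ (2 * a + l) * cos theta ^+ (2 * n) by rewrite mulr_gt0 // exprn_gt0.
have rho0 := lt_le_trans X0 Hge.
have Ln0 : 0 <= L ^+ 2 / n%:R by rewrite divr_ge0 // exprn_ge0 // ltW.
have : ln (c ^+ (2 * a + l) * cos theta ^+ (2 * n)) <= ln (return_prob w (2 * n) 0).
  by rewrite ler_ln ?posrE.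
move=> /(ler_wpM2l Ln0); apply: le_trans.
(* The stay is compared with the main term, the journey with [1 - r]. *)
rewrite lnM ?posrE ?exprn_gt0 // !lnXn // mulrDr [leRHS]addrC; apply: lerD.
  apply: (@le_trans _ _ (L ^+ 2 / n%:R * ((- (theta ^+ 2 / 2 / r)) *+ (2 * n)))); last first.
    by rewrite ler_wpM2l // lerMn2r lct orbT.
  rewrite -[_ *+ (2 * n)]mulr_natr natrM.
  rewrite [leRHS](_ : _ = - ((theta * L) ^+ 2 / r)); last first.
    by field; rewrite !gt_eqF.
  rewrite lerN2 -/s ler_pdivrMr // (_ : _ / r ^+ 5 * r = (s / r ^+ 2) ^+ 2); last first.
    by field; rewrite gt_eqF.
  have H : theta * L <= s / r ^+ 2.
    by rewrite ler_pdivlMr ?exprn_gt0 // -mulrA [L * _]mulrC.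
  have t1 : 0 <= theta * L by rewrite mulr_ge0 // ltW.
  by rewrite ler_sqr ?nnegrE // (le_trans t1 H).
rewrite -[_ *+ (2 * a + l)]mulr_natr lerNl.
apply: (@le_trans _ _ (L ^+ 2 / n%:R * (S * L ^+ 2 * expR (r * L)) * (- ln c))).
  rewrite [leLHS](_ : _ = L ^+ 2 / n%:R * (2 * a + l)%:R * (- ln c)); last by ring.
  by rewrite ler_wpM2r ?(ltW lnc) // ler_wpM2l.
have := HCa _ LCa.
rewrite mulrAC ler_pdivrMr // => Hc.
rewrite [leLHS](_ : _ = S * - ln c * L ^+ 4 * expR (r * L) / n%:R); last by ring.
rewrite ler_pdivrMr // nsplit [leRHS]mulrCA [leLHS]mulrC ler_pM2l //.
by rewrite [leRHS]mulrC.
Unshelve. all: by end_near. Qed.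

(** * Almost sure rates and the limit *)

Section AlmostSureRates.
Variables (R : realType) (P : probability (env R) R).
Hypotheses (indep : sites_independent P) (ident : sites_identically_distributed P).
Hypothesis elliptic : exists c : R, 0 < c /\
  forall x : int, P [set w : env R | c <= w x <= 1 - c] = 1%E.
Hypothesis drift : P [set w : env R | 2^-1 <= w 0] = 1%E.
Variable alpha : R.
Hypotheses (alphaE : P [set w : env R | w 0 = 2^-1] = alpha%:E)
  (alpha_itv : 0 < alpha < 1).

Lemma ae_environment : exists2 c : R, 0 < c &
  {ae P, forall w : env R,
    (forall x, c <= w x <= 1 - c) /\ (forall x, 2^-1 <= w x)}.
Proof.
have [c [c0 hc]] := elliptic; exists c => //.
have mc : measurable [set y : R | c <= y <= 1 - c].
  rewrite (_ : [set _ | _] = `[c, 1 - c]%classic); first exact: measurable_itv.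
  by apply/seteqP; split=> y /=; rewrite in_itv.
apply: filterS2 (ae_sites ident mc (hc 0)) (ae_sites ident (measurable_ge _) drift).
by move=> w.
Qed.

Lemma ae_return_rate (r : R) : 0 < r < 1 ->
  {ae P, forall w : env R, \forall n \near \oo,
    - ((pi * - ln alpha / 2) ^+ 2 / r ^+ 5) - (1 - r)
      <= ln n%:R ^+ 2 / n%:R * ln (return_prob w (2 * n) 0)
      <= - (r ^+ 9 * (pi * - ln alpha / 2) ^+ 2)}.
Proof.
move=> r01; have /andP[r0 r1] := r01; have /andP[a0 a1] := alpha_itv.
have pi0 := pi_gt0 R.
set g := - ln alpha; have g0 : 0 < g by rewrite oppr_gt0 ln_lt0.
have alphaexp : alpha = expR (- g) by rewrite opprK lnK.
(* This [beta] is [alpha] to the power [r], so that [beta^-1 ^+ l] is the scale [expR (r * g) ^+ l]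
   of the upper bound. *)
have beta_itv : alpha < expR (- (r * g)) < 1.
  rewrite alphaexp ltr_expR ltrN2 expR_lt1 oppr_lt0 mulr_gt0 // andbT.
  by rewrite gtr_pMl.
have [p p01 drifts] := ae_many_drifts indep ident drift alphaE alpha_itv beta_itv.
have [p2 p1] := andP p01.
pose q := 1 - (2 * p - 1) * cos (r * (pi / 2)) ^+ 2.
have cM : 0 < cos (r * (pi / 2)).
  apply: cos_gt0_pihalf; rewrite gtr_pMl ?divr_gt0 // r1 andbT.
  by apply: (@lt_trans _ _ 0); rewrite ?oppr_lt0 ?mulr_gt0 ?divr_gt0.
(* Drift sites contract strictly, so that some number [K] of them brings [q ^+ K] below [1 - r]. *)
have q1 : `|q| < 1.
  have c2 : 0 < cos (r * (pi / 2)) ^+ 2 by rewrite exprn_gt0.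
  have c21 : cos (r * (pi / 2)) ^+ 2 <= 1 by rewrite exprn_ile1 ?cos_le1 // ltW.
  have m0 : 0 < (2 * p - 1) * cos (r * (pi / 2)) ^+ 2 by rewrite mulr_gt0 //; lra.
  have m1 : (2 * p - 1) * cos (r * (pi / 2)) ^+ 2 <= 1.
    by rewrite mulr_ile1 ?(ltW c2) //; lra.
  by rewrite ger0_norm /q ?subr_ge0 // gtrDl oppr_lt0.
have [K qK] : exists K, q ^+ K <= 1 - r.
  have [K _ HK] : \forall K \near \oo, q ^+ K < 1 - r.
    by apply: (cvgr_lt _ (cvg_expr q1)); rewrite subr_gt0.
  by exists K; rewrite ltW // HK //=.
have [c c0 good] := ae_environment.
have runs := ae_fair_run indep ident alphaE alpha_itv.
apply: filterS3 good (drifts K) runs => w [wc whalf] [l1 _ H1] [l2 _ H2].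
have w01 x : 0 < w x < 1 by exact: site_itv.
have p01' : 2^-1 <= p <= 1 by rewrite ltW.
have up := @return_rate_upper R w g r c p q K l1 g0 r01 w01 whalf c0 wc p01' erefl qK.
have lo := @return_rate_lower R w g r c l2 g0 r01 w01 whalf c0 wc.
have {}up := up _; have {}lo := lo _.
have {}up : \forall n \near \oo, ln n%:R ^+ 2 / n%:R * ln (return_prob w (2 * n) 0)
    <= - (r ^+ 9 * (pi * g / 2) ^+ 2).
  apply: up => l l1l x xl; apply: (H1 l l1l).
  by rewrite expRN invrK.
have {}lo : \forall n \near \oo, - ((pi * g / 2) ^+ 2 / r ^+ 5) - (1 - r)
    <= ln n%:R ^+ 2 / n%:R * ln (return_prob w (2 * n) 0).
  apply: lo => l l2l; have := H2 l l2l.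
  by rewrite {1}alphaexp expRN invrK.
by apply: filterS2 lo up => n -> ->.
Qed.

End AlmostSureRates.

(** Both bounds tend to [- A] as [k] grows, so a single [k] puts them within [e] of the limit. *)
Lemma cvg_of_rates (R : realType) (A : R) (u : nat -> R) :
  (forall k, \forall n \near \oo,
    - (A / (1 - k.+2%:R^-1) ^+ 5) - (1 - (1 - k.+2%:R^-1)) <= u n
      <= - ((1 - k.+2%:R^-1) ^+ 9 * A)) ->
  u n @[n --> \oo] --> - A.
Proof.
move=> H.
have rcvg : (1 - k.+2%:R^-1 : R) @[k --> \oo] --> (1 : R).
  rewrite -[X in _ --> X]subr0; apply: cvgB; first exact: cvg_cst.
  have -> : (fun k => k.+2%:R^-1 : R) = (fun k => harmonic (k + 1)%N).
    by apply/funext => k; rewrite addn1.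
  by rewrite cvg_shiftn; exact: cvg_harmonic.
set r := (fun k : nat => _) in rcvg.
have rX m : r k ^+ m @[k --> \oo] --> (1 ^+ m : R).
  elim: m => [|m IH]; first exact: cvg_cst.
  rewrite exprS (_ : (fun k => _) = (fun k => r k * r k ^+ m)).
    exact: cvgM.
  by apply/funext => k; rewrite exprS.
have lo : (- (A / r k ^+ 5) - (1 - r k)) @[k --> \oo] --> - A.
  rewrite -[X in _ --> X](_ : - (A / 1 ^+ 5) - (1 - 1) = - A); last first.
    by rewrite expr1n divr1 subrr subr0.
  apply: cvgB; last by apply: cvgB => //; exact: cvg_cst.
  apply: cvgN; apply: cvgM; first exact: cvg_cst.
  by apply: cvgV; [rewrite expr1n oner_neq0|exact: rX].
have up : (- (r k ^+ 9 * A)) @[k --> \oo] --> - A.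
  rewrite -[X in _ --> X](_ : - (1 ^+ 9 * A) = - A); last by rewrite expr1n mul1r.
  by apply: cvgN; apply: cvgM; [exact: rX|exact: cvg_cst].
apply/cvgrPdist_le => e e0.
have [k [k1 k2]] : exists k, `|- A - (- (A / r k ^+ 5) - (1 - r k))| <= e /\
    `|- A - (- (r k ^+ 9 * A))| <= e.
  move/cvgrPdist_le: lo => /(_ e e0) lo; move/cvgrPdist_le: up => /(_ e e0) up.
  have [k _ Hk] := filterI lo up.
  by exists k; have [] := Hk k (leqnn k).
apply: filterS (H k) => n /andP[]; rewrite -/(r k).
move: k1 k2; rewrite !ler_norml.
by move: (r k) (_ * A) (A / _) => x y z /andP[? ?] /andP[? ?] ? ?; apply/andP; split; lra.
Unshelve. all: by end_near. Qed.

Theorem lemma3p3 (R : realType) (P : probability (env R) R)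
    (indep : sites_independent P)
    (ident : sites_identically_distributed P)
    (elliptic : exists c : R, 0 < c /\
       forall x : int, P [set w : env R | c <= w x <= 1 - c] = 1%E)
    (drift : P [set w : env R | 2^-1 <= w 0] = 1%E)
    (alpha : R) (alphaE : P [set w : env R | w 0 = 2^-1] = alpha%:E)
    (alpha_itv : 0 < alpha < 1)
    (d : measure_display) (Om : measurableType d)
    (Pq : env R -> probability Om R) (X : nat -> Om -> int)
    (walk : forall w : env R, quenched_walk w (Pq w) X) :
  {ae P, forall w : env R,
    (ln n%:R ^+ 2 / n%:R * ln (fine (Pq w [set o | X (2 * n)%N o = 0])))
      @[n --> \oo] --> - (`|pi * ln alpha| ^+ 2 / 4)}.
Proof.
(* The null set excluded by [ae_return_rate] depends on [r], so only a sequence of values tending to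
   1 is used. *)
have r01 k : 0 < 1 - (k.+2%:R^-1 : R) < 1.
  by rewrite subr_gt0 invf_lt1 // ltr1n ltrBlDr ltrDl invr_gt0 ltr0n.
have rate k := ae_return_rate indep ident elliptic drift alphaE alpha_itv (r01 k).
have {rate} := ae_foralln rate.
apply: filterS => w rate.
under eq_fun do rewrite (quenched_return_prob (walk w)).
rewrite (_ : _ / 4 = (pi * - ln alpha / 2) ^+ 2); last first.
  by rewrite real_normK ?num_real //; field.
exact: cvg_of_rates.
Qed.
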